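(* Let $r>0$ and let $K=rB^2$ be the closed circular disc of radius $r$. For each positive integer $n$ let $K_n^r=\mathrm{conv}_r(X_n)$ be the uniform random disc-polygon in $K$ generated by $n$ independent uniform random points of $K$. Then there are constants $0<c\le C$, depending only on $r$, and an integer $n_0$ such that for all $n\ge n_0$ $$c\le \mathrm{Var}\,(f_0(K_n^r))\le C\qquad\text{and}\qquad \mathrm{Var}\,(A(K_n^r))\le C\, n^{-2}.$$
   Context: $B^2$ is the closed unit disc of $\mathbb{R}^2$ centred at the origin. For $X\subset K=rB^2$, the closed $r$-hyperconvex hull $\mathrm{conv}_r(X)$ is the intersection of all closed circular discs of radius $r$ that contain $X$; it is contained in $K$. Let $X_n=\{x_1,\dots,x_n\}$ be a sample of $n$ independent random points chosen from $K$ according to the uniform probability distribution, and let $K_n^r=\mathrm{conv}_r(X_n)$. $A(\cdot)$ denotes area, $f_0(K_n^r)$ denotes the number of vertices of the disc-polygon $K_n^r$ (equivalently, almost surely, the number of points $x_i$ with $x_i\notin\mathrm{conv}_r(X_n\setminus\{x_i\})$), and $\mathrm{Var}$ denotes variance. *)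

(* Defs.v *)
From HB Require Import structures.
From mathcomp Require Import all_boot all_order all_algebra finmap.
From mathcomp Require Import all_classical all_reals all_analysis.
Import Order.TTheory GRing.Theory Num.Theory.
Import numFieldNormedType.Exports.

Set Implicit Arguments.
Unset Strict Implicit.
Unset Printing Implicit Defensive.

Local Open Scope classical_set_scope.
Local Open Scope ring_scope.

(* The Euclidean plane. The norm that the libraries put on a product is the max
   norm, so the Euclidean distance is written out. *)
Definition plane (R : realType) := (measurableTypeR R * measurableTypeR R)%type.

Definition dist2 (R : realType) (p q : plane R) : R :=
  Num.sqrt (((p.1 : R) - q.1) ^+ 2 + ((p.2 : R) - q.2) ^+ 2).

Definition disc (R : realType) (c : plane R) (r : R) : set (plane R) :=
  [set p | dist2 c p <= r].

Definition area (R : realType) (A : set (plane R)) : \bar R :=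
  (@lebesgue_measure R \x @lebesgue_measure R)%E A.

(* The closed r-hyperconvex hull. It is the whole plane when no disc of radius r
   contains X; for X included in a disc of radius r this does not occur. *)
Definition rhull (R : realType) (r : R) (X : set (plane R)) : set (plane R) :=
  \bigcap_(c in [set c | X `<=` disc c r]) disc c r.

(* The vertices of a disc-polygon S of radius r are the points where two of the
   circular arcs bounding S meet, that is, the points of S lying on the boundary
   circles of two distinct discs of radius r containing S (at any other boundary
   point, the supporting disc of radius r is unique). *)
Definition vertices (R : realType) (r : R) (S : set (plane R)) :
    set (plane R) :=
  [set p | S p /\ exists c1 c2 : plane R,
    [/\ c1 <> c2, S `<=` disc c1 r, S `<=` disc c2 r,
        dist2 c1 p = r & dist2 c2 p = r]].

(* [fset_set A] is a finite set with the elements of A when A is finite, and is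
   empty otherwise. The r-hyperconvex hull of a finite set has finitely many
   vertices, all of them in that set. *)
Definition f0 (R : realType) (r : R) (S : set (plane R)) : nat :=
  #|` fset_set (vertices r S)|%fset.

Definition uniform_on (d : measure_display) (T : measurableType d)
    (R : realType) (P : probability T R) (K : set (plane R))
    (X : {RV P >-> plane R}) : Prop :=
  forall B : set (plane R), measurable B ->
    distribution P X B = (area (B `&` K) / area K)%E.

(* Subfamilies are covered by taking B i = setT for the other indices. *)
Definition mutually_independent (d d' : measure_display)
    (T : measurableType d) (T' : measurableType d') (R : realType)
    (P : probability T R) (I : finType) (X : I -> {RV P >-> T'}) : Prop :=
  forall B : I -> set T', (forall i, measurable (B i)) ->
    P (\bigcap_(i in [set: I]) (X i @^-1` B i)) =
    (\prod_(i : I) P (X i @^-1` B i))%E.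

Definition uniform_sample (d : measure_display) (T : measurableType d)
    (R : realType) (P : probability T R) (K : set (plane R)) (n : nat)
    (X : 'I_n -> {RV P >-> plane R}) : Prop :=
  mutually_independent X /\ forall i, uniform_on K (X i).

Definition random_disc_polygon (d : measure_display) (T : measurableType d)
    (R : realType) (P : probability T R) (r : R) (n : nat)
    (X : 'I_n -> {RV P >-> plane R}) (w : T) : set (plane R) :=
  rhull r [set X i w | i in [set: 'I_n]].

(* Main.v *)
Require Import Defs.
From HB Require Import structures.
From mathcomp Require Import all_boot all_order all_algebra finmap.
From mathcomp Require Import all_classical all_reals all_analysis.
From mathcomp Require Import measurable_realfun ring lra zify.
Import Order.TTheory GRing.Theory Num.Theory.
Import numFieldNormedType.Exports.
Local Open Scope classical_set_scope.
Local Open Scope ring_scope.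

Set Implicit Arguments.
Unset Strict Implicit.
Unset Printing Implicit Defensive.

(** The hull of points of K = rB is governed by its r-dual: the set of the
    centres c of the discs of radius r containing all the points.  The hull is
    the intersection of these discs, the r-dual contains the origin, and if it
    lies in the disc of radius s about the origin then

    - the hull contains every point at distance less than r - s from the origin
      ([disc_sub_rhull]), so that A(K) - A(hull) is at most the area of a rim of
      width s, which is O(s) ([area_rim_le]);
    - every vertex of the hull is a sample point ([vertices_sub]) in that rim
      ([vertex_in_rim]).

    The radius of the r-dual is of order 1/n with an exponential tail.  Indeed
    three fixed thin strips of depth h along the circle, about a third of a turn
    apart, force the r-dual into the disc of radius 20h as soon as each of them
    contains a sample point ([rdual_tri]); each has probability at least a
    constant times h, hence some strip of depth proportional to k/n is missed by
    n points with probability at most 3 q^k, for a fixed q < 1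
    ([tri_miss_prob]).  On the event attached to k the missing area is O(k/n),
    and the square of the number of vertices is at most the number of pairs of
    sample points in a rim of width O(k/n), a pair of distinct points having
    probability O((k/n)^2).  Summing k^2 q^k bounds the second moment of the
    number of vertices by a constant ([f0_var_le]), and that of the missing area
    by a constant times 1/n^2 ([area_var_le]).

    For the lower bound, two configurations have probability bounded below by
    the same positive constant: one sample point in each of the three strips of
    depth of order 1/n and no other point in the rim, which leaves at most three
    vertices ([tri_f0_le]); and one point in each of four strips near the
    diagonals with no other point in the rim, which makes all four of them
    vertices ([quad_f0_ge]).  Whatever the mean is, it is at distance at least
    1/2 from the number of vertices in one of the two configurations
    ([f0_var_ge]).

    The integral of a nonnegative function is by definition the supremum of the
    integrals of the simple functions below it.  It is therefore monotone even
    on non-measurable functions, which is why both random variables are only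
    ever compared with finite combinations of indicators of product events. *)

(** * Lower integrals and variances of functions that need not be measurable *)

(** The supremum over the simple functions below f grows with f, measurable or
    not. *)
Lemma ge0_le_integral_nomeas d (T : measurableType d) (R : realType)
    (mu : {measure set T -> \bar R}) (f g : T -> \bar R) :
  (forall x, (0 <= f x)%E) -> (forall x, (f x <= g x)%E) ->
  (\int[mu]_x f x <= \int[mu]_x g x)%E.
Proof.
move=> f0 fg; have g0 x : (0 <= g x)%E by apply: le_trans (fg x).
rewrite !ge0_integralTE//; apply: ereal_sup_le => _ [h hf <-]; exists h => //=.
by move=> x; apply: le_trans (hf x) (fg x).
Qed.

Lemma integral_sum_indic d (T : measurableType d) (R : realType)
    (mu : {measure set T -> \bar R}) (I : finType) (a : I -> R)
    (F : I -> set T) :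
  (forall s, 0 <= a s) -> (forall s, measurable (F s)) ->
  (\int[mu]_w (\sum_s a s * \1_(F s) w)%:E = \sum_s (a s)%:E * mu (F s))%E.
Proof.
move=> a0 mF.
under eq_integral do rewrite -sumEFin.
rewrite ge0_integral_sum//=.
- apply: eq_bigr => s _; under eq_integral do rewrite EFinM.
  rewrite ge0_integralZl_EFin//; first by rewrite integral_indic ?setIT.
  by apply/measurable_EFinP; exact: measurable_indic.
- move=> s; apply/measurable_EFinP; apply: measurable_funM => //.
- by move=> s x _; rewrite lee_fin mulr_ge0.
Qed.

Lemma measurable_sum_indic d (T : measurableType d) (R : realType)
    (I : finType) (a : I -> R) (F : I -> set T) :
  (forall s, measurable (F s)) ->
  measurable_fun setT (fun w => \sum_s a s * \1_(F s) w : R).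
Proof.
move=> mF; apply: measurable_sum => s; apply: measurable_funM => //.
Qed.

(** On the null set N the bound is replaced by the measurable function +oo,
    which has integral 0 there; monotonicity does the rest. *)
Lemma integral_le_sum_indic d (T : measurableType d) (R : realType)
    (P : probability T R) (I : finType) (a p : I -> R) (F : I -> set T)
    (N : set T) (f : T -> R) :
  (forall s, 0 <= a s) -> (forall s, measurable (F s)) ->
  (forall s, (P (F s) <= (p s)%:E)%E) -> measurable N -> P N = 0%E ->
  (forall w, 0 <= f w) ->
  (forall w, ~ N w -> f w <= \sum_s a s * \1_(F s) w) ->
  (\int[P]_w (f w)%:E <= (\sum_s a s * p s)%:E)%E.
Proof.
move=> a0 mF pF mN PN f0 fle.
have step0 w : 0 <= \sum_s a s * \1_(F s) w :> R.
  by apply: sumr_ge0 => s _; rewrite mulr_ge0.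
apply: (@le_trans _ _ (\int[P]_w ((\sum_s a s * \1_(F s) w)%:E
    + +oo * (\1_N w)%:E))%E).
  apply: ge0_le_integral_nomeas => w; first by rewrite lee_fin.
  rewrite indicE; case: (boolP (w \in N)) => [|/negP wN].
    by rewrite mule1 addey// leey.
  rewrite mule0 adde0 lee_fin; apply: fle => Nw; apply: wN; exact: mem_set.
rewrite ge0_integralD//=; last 3 first.
- by move=> w _; rewrite lee_fin.
- by apply/measurable_EFinP; exact: measurable_sum_indic.
- by apply: measurable_funeM; apply/measurable_EFinP; exact: measurable_indic.
rewrite integral_sum_indic// ge0_integralZl//; last first.
  by apply/measurable_EFinP; exact: measurable_indic.
rewrite integral_indic// setIT /= PN mule0 adde0 -sumEFin.
by apply: lee_sum => s _; rewrite EFinM; apply: lee_wpmul2l;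
  [rewrite lee_fin|exact: pF].
Qed.

Lemma integral_ge_sum_indic d (T : measurableType d) (R : realType)
    (P : probability T R) (I : finType) (a p : I -> R) (F : I -> set T)
    (f : T -> R) :
  (forall s, 0 <= a s) -> (forall s, measurable (F s)) ->
  (forall s, ((p s)%:E <= P (F s))%E) ->
  (forall w, \sum_s a s * \1_(F s) w <= f w) ->
  ((\sum_s a s * p s)%:E <= \int[P]_w (f w)%:E)%E.
Proof.
move=> a0 mF pF fle.
have step0 w : 0 <= \sum_s a s * \1_(F s) w :> R.
  by apply: sumr_ge0 => s _; rewrite mulr_ge0.
apply: (@le_trans _ _ (\int[P]_w ((\sum_s a s * \1_(F s) w)%:E))%E).
  rewrite integral_sum_indic// -sumEFin; apply: lee_sum => s _.
  by rewrite EFinM; apply: lee_wpmul2l; [rewrite lee_fin|exact: pF].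
by apply: ge0_le_integral_nomeas => w; rewrite lee_fin.
Qed.

(** A lower integral is not additive, so the bound cannot be moved to the other
    side under the integral. The argument goes through the measurable function h
    = max (0, c - g) off N, which lies below f and satisfies c <= h + g up to
    the null set. *)
Lemma integral_ge_cst_sub_sum_indic d (T : measurableType d) (R : realType)
    (P : probability T R) (I : finType) (a p : I -> R) (F : I -> set T)
    (N : set T) (c : R) (f : T -> R) :
  (forall s, 0 <= a s) -> (forall s, measurable (F s)) ->
  (forall s, (P (F s) <= (p s)%:E)%E) -> measurable N -> P N = 0%E -> 0 <= c ->
  (forall w, 0 <= f w) ->
  (forall w, ~ N w -> c - \sum_s a s * \1_(F s) w <= f w) ->
  ((c - \sum_s a s * p s)%:E <= \int[P]_w (f w)%:E)%E.
Proof.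
move=> a0 mF pF mN PN c0 f0 fle.
pose g w : R := \sum_s a s * \1_(F s) w.
pose h w : R := Num.max 0 (c - g w) * \1_(~` N) w.
have mh : measurable_fun setT h.
  apply: measurable_funM => //; last first.
    by apply: measurable_indic; exact: measurableC.
  apply: measurable_maxr => //; apply: measurable_funB => //.
  exact: measurable_sum_indic.
have h0 w : 0 <= h w by rewrite /h mulr_ge0// le_max lexx.
have hf : (\int[P]_w (h w)%:E <= \int[P]_w (f w)%:E)%E.
  apply: ge0_le_integral_nomeas => w; rewrite lee_fin// /h indicE.
  case: (boolP (w \in ~` N)) => [/set_mem wN|]; last by rewrite mulr0.
  by rewrite mulr1 ge_max f0 fle.
apply: le_trans hf.
have : (\int[P]_w c%:E <= \int[P]_w ((h w)%:E + (g w + c * \1_N w)%:E))%E.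
  apply: ge0_le_integral_nomeas => w; rewrite lee_fin//.
  rewrite /h !indicE in_setC; case: (boolP (w \in N)) => _ /=.
    rewrite mulr0 mulr1 add0r lerDr; apply: sumr_ge0 => s _.
    by rewrite mulr_ge0.
  by rewrite mulr1 mulr0 addr0 -lerBlDr le_max lexx orbT.
have -> : (\int[P]__ c%:E = c%:E)%E.
  by rewrite (integral_cst P measurableT c%:E)/= probability_setT mule1.
rewrite ge0_integralD//; last 4 first.
- by move=> w _; rewrite lee_fin.
- by apply/measurable_EFinP.
- move=> w _; rewrite lee_fin addr_ge0//; last by rewrite mulr_ge0.
  by apply: sumr_ge0 => s _; rewrite mulr_ge0.
- apply/measurable_EFinP/measurable_funD; first exact: measurable_sum_indic.
  by apply: measurable_funM.
have gE : (\int[P]_w (g w + c * \1_N w)%:E <= (\sum_s a s * p s)%:E)%E.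
  apply: (@integral_le_sum_indic _ _ _ _ _ _ _ F N) => // w.
    rewrite addr_ge0//; last by rewrite mulr_ge0.
    by apply: sumr_ge0 => s _; rewrite mulr_ge0.
  move=> wN; rewrite indicE; case: (boolP (w \in N)) => [/set_mem//|_].
  by rewrite mulr0 addr0.
move=> cle; rewrite EFinB leeBlDr//; apply: le_trans cle _.
by rewrite leeD2l.
Qed.

(** The constant is one more term of the sum, on the event setT. *)
Lemma integral_le_cst_sum_indic d (T : measurableType d) (R : realType)
    (P : probability T R) (I : finType) (a p : I -> R) (F : I -> set T)
    (N : set T) (c : R) (f : T -> R) :
  (forall s, 0 <= a s) -> (forall s, measurable (F s)) ->
  (forall s, (P (F s) <= (p s)%:E)%E) -> measurable N -> P N = 0%E -> 0 <= c ->
  (forall w, 0 <= f w) ->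
  (forall w, ~ N w -> f w <= c + \sum_s a s * \1_(F s) w) ->
  (\int[P]_w (f w)%:E <= (c + \sum_s a s * p s)%:E)%E.
Proof.
move=> a0 mF pF mN PN c0 f0 fle.
pose a' (s : 'I_1 + I) := if s is inr s then a s else c.
pose p' (s : 'I_1 + I) := if s is inr s then p s else 1.
pose F' (s : 'I_1 + I) := if s is inr s then F s else setT.
have -> : c + \sum_s a s * p s = \sum_s a' s * p' s.
  by rewrite big_sumType /= big_ord1 mulr1.
apply: (integral_le_sum_indic (F := F') (N := N)) => //.
- by case.
- by case=> [?|?]; [exact: measurableT|exact: mF].
- by case=> [?|s]; [rewrite /F' /= probability_setT|exact: pF].
move=> w /fle; rewrite big_sumType /= big_ord1 /= indicT mulr1.
by [].
Qed.

Lemma variance_integral d (T : measurableType d) (R : realType)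
    (P : probability T R) (f : T -> R) :
  'V_P[f] = (\int[P]_w ((f w - fine 'E_P[f]) ^+ 2)%:E)%E.
Proof.
rewrite /variance unlock [in LHS]unlock; apply: eq_integral => w _.
by rewrite expr2 [in RHS]unlock.
Qed.

Lemma mean_integral d (T : measurableType d) (R : realType)
    (P : probability T R) (f : T -> R) : ('E_P[f])%E = (\int[P]_w (f w)%:E)%E.
Proof. by rewrite unlock. Qed.

Lemma mean_ge0 d (T : measurableType d) (R : realType)
    (P : probability T R) (f : T -> R) : (forall w, 0 <= f w) ->
  0 <= fine ('E_P[f])%E.
Proof. by move=> f0; rewrite fine_ge0// mean_integral integral_ge0// => w _;
  rewrite lee_fin. Qed.

Lemma mean_fin_num d (T : measurableType d) (R : realType)
    (P : probability T R) (f : T -> R) (M : R) : (forall w, 0 <= f w) ->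
  ('E_P[f] <= M%:E)%E -> ('E_P[f])%E \is a fin_num.
Proof.
move=> f0 fM; rewrite ge0_fin_numE; first exact: le_lt_trans fM (ltry _).
by rewrite mean_integral integral_ge0// => w _; rewrite lee_fin.
Qed.

Lemma mean_le d (T : measurableType d) (R : realType)
    (P : probability T R) (f : T -> R) (M : R) : (forall w, 0 <= f w) ->
  ('E_P[f] <= M%:E)%E -> fine ('E_P[f])%E <= M.
Proof. by move=> f0 fM; rewrite -lee_fin fineK// (mean_fin_num f0 fM). Qed.

(** * Areas in the Euclidean plane *)

Definition nsq (R : realType) (p : plane R) : R := (p.1 : R) ^+ 2 +
    (p.2 : R) ^+ 2.

Lemma nsq_ge0 (R : realType) (p : plane R) : 0 <= nsq p.
Proof. by rewrite /nsq addr_ge0// sqr_ge0. Qed.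

Lemma dist2_le (R : realType) (p q : plane R) (r : R) : 0 <= r ->
  (dist2 p q <= r) = (((p.1 : R) - q.1) ^+ 2 + ((p.2 : R) - q.2) ^+ 2 <=
    r ^+ 2).
Proof. by move=> r0; rewrite /dist2 -{1}(ger0_norm r0) -sqrtr_sqr ler_sqrt
  ?sqr_ge0. Qed.

Lemma dist2_lt (R : realType) (p q : plane R) (r : R) : 0 <= r ->
  (dist2 p q < r) = (((p.1 : R) - q.1) ^+ 2 + ((p.2 : R) - q.2) ^+ 2 < r ^+ 2).
Proof.
move=> r0; have [->|rn0] := eqVneq r 0.
  by rewrite expr0n /= /dist2 !ltNge sqrtr_ge0 addr_ge0 ?sqr_ge0.
rewrite /dist2 -{1}(ger0_norm r0) -sqrtr_sqr ltr_sqrt// exprn_gt0//.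
by rewrite lt_def rn0.
Qed.

Lemma dist2_eq (R : realType) (p q : plane R) (r : R) : 0 <= r ->
  (dist2 p q == r) = (((p.1 : R) - q.1) ^+ 2 + ((p.2 : R) - q.2) ^+ 2 ==
    r ^+ 2).
Proof. by move=> r0; rewrite !eq_le dist2_le// !leNgt dist2_lt. Qed.

Lemma sqd0 (R : realType) (p : plane R) :
  (((0, 0) : plane R).1 - (p.1 : R)) ^+ 2 +
    (((0, 0) : plane R).2 - (p.2 : R)) ^+ 2 = nsq p.
Proof. by rewrite /= !sub0r !sqrrN. Qed.

Lemma measurable_nsq (R : realType) : measurable_fun setT (@nsq R).
Proof.
by apply: measurable_funD; apply: measurable_funX;
  [exact: measurable_fst|exact: measurable_snd].
Qed.

Lemma measurable_nsq_le (R : realType) (t : R) :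
  measurable [set p : plane R | nsq p <= t].
Proof.
have -> : [set p : plane R | nsq p <= t] = setT `&` (@nsq R @^-1` `]-oo, t]).
  by rewrite setTI; apply/seteqP; split => p /=; rewrite in_itv.
by apply: measurable_nsq.
Qed.

Lemma measurable_nsq_lt (R : realType) (t : R) :
  measurable [set p : plane R | nsq p < t].
Proof.
have -> : [set p : plane R | nsq p < t] = setT `&` (@nsq R @^-1` `]-oo, t[).
  by rewrite setTI; apply/seteqP; split => p /=; rewrite in_itv.
by apply: measurable_nsq.
Qed.

Lemma disc0E (R : realType) (r : R) : 0 <= r ->
  disc ((0, 0) : plane R) r = [set p | nsq p <= r ^+ 2].
Proof. by move=> r0; apply/seteqP; split => p;
  rewrite /disc /= dist2_le// sqd0. Qed.

Lemma measurable_disc0 (R : realType) (r : R) : 0 <= r ->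
  measurable (disc ((0, 0) : plane R) r).
Proof. by move=> r0; rewrite disc0E//; exact: measurable_nsq_le. Qed.

(** The points at distance in ]r - h2, r - h1] from the origin whose abscissa is
    in [a, b], on the side of the horizontal axis given by the sign sg: each
    vertical section is an interval between two concentric circles, so that the
    area is controlled by Fubini without polar coordinates. *)
Definition strip (R : realType) (r a b sg h1 h2 : R) : set (plane R) :=
  [set p | (r - h2) ^+ 2 < nsq p] `&` [set p | nsq p <= (r - h1) ^+ 2] `&`
  [set p | a <= (p.1 : R) <= b] `&` [set p | 0 < sg * (p.2 : R)].

Lemma measurable_strip (R : realType) (r a b sg h1 h2 : R) :
  measurable (strip r a b sg h1 h2).
Proof.
apply: measurableI; last first.
  have -> : [set p : plane R | 0 < sg * (p.2 : R)] =
      setT `&` ((fun p : plane R => sg * (p.2 : R)) @^-1` `]0, +oo[).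
    by rewrite setTI; apply/seteqP; split => p /=; rewrite in_itv /= andbT.
  have mf : measurable_fun setT (fun p : plane R => sg * (p.2 : R)).
    by apply: measurable_funM => //; exact: measurable_snd.
  by apply: mf.
apply: measurableI; last first.
  have -> : [set p : plane R | a <= (p.1 : R) <= b] =
      setT `&` ((fun p : plane R => (p.1 : R)) @^-1` `[a, b]).
    by rewrite setTI; apply/seteqP; split => p /=; rewrite in_itv.
  by apply: measurable_fst.
apply: measurableI; last exact: measurable_nsq_le.
have -> : [set p : plane R | (r - h2) ^+ 2 < nsq p] =
    setT `&` (@nsq R @^-1` `](r - h2) ^+ 2, +oo[).
  by rewrite setTI; apply/seteqP; split => p /=; rewrite in_itv/= andbT.
by apply: measurable_nsq.
Qed.

(** The integral over x that defines the product measure dominates that of c on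
    [a, b]. *)
Lemma area_ge_xsection (R : realType) (A : set (plane R)) (a b c : R) :
  a <= b -> 0 <= c ->
  (forall x : measurableTypeR R, a <= x <= b ->
    (c%:E <= @lebesgue_measure R (xsection A x))%E) ->
  (((b - a) * c)%:E <= area A)%E.
Proof.
move=> ab c0 H; rewrite /area /product_measure1.
apply: (@le_trans _ _ (\int[@lebesgue_measure R]_x
  (c%:E * (\1_(`[a, b]%classic) x)%:E))%E).
  rewrite ge0_integralZl_EFin//; last first.
    by apply/measurable_EFinP; exact: measurable_indic.
  rewrite integral_indic// setIT /= lebesgue_measure_itv /= lte_fin.
  case: ltP => // ba; first by rewrite -EFinB -EFinM mulrC.
  by rewrite mule0 lee_fin (le_anti (introT andP (conj ab ba))) subrr mul0r.
apply: ge0_le_integral_nomeas => x; first by rewrite mule_ge0// lee_fin.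
rewrite indicE; case: (boolP (x \in `[a, b]%classic)) => xab;
  last by rewrite mule0.
by rewrite mule1; apply: H; move: xab; rewrite inE /= in_itv.
Qed.

Lemma area_le_xsection (R : realType) (A : set (plane R)) (w c : R) :
  0 <= w -> 0 <= c -> (forall p, A p -> `|p.1 : R| <= w) ->
  (forall x : measurableTypeR R, (`|x : R| <= w) ->
    (@lebesgue_measure R (xsection A x) <= c%:E)%E) ->
  (area A <= ((w + w) * c)%:E)%E.
Proof.
move=> w0 c0 Aw H; rewrite /area /product_measure1.
apply: (@le_trans _ _ (\int[@lebesgue_measure R]_x
  (c%:E * (\1_(`[- w, w]%classic) x)%:E))%E); last first.
  rewrite ge0_integralZl_EFin//; last first.
    by apply/measurable_EFinP; exact: measurable_indic.
  rewrite integral_indic// setIT /= lebesgue_measure_itv /= lte_fin.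
  case: ltP => // _; first by rewrite -EFinB opprK -EFinM mulrC.
  by rewrite mule0 lee_fin mulr_ge0// addr_ge0.
apply: ge0_le_integral_nomeas => x; first by [].
rewrite indicE; case: (boolP (x \in `[- w, w]%classic)) => xw.
  by rewrite mule1; apply: H; move: xw; rewrite inE /= in_itv /= ler_norml.
rewrite mule0 /= (_ : xsection A x = set0) ?measure0//.
apply/seteqP; split => // y; rewrite /xsection /= inE => /Aw /=.
by rewrite ler_norml => xw'; move: xw; rewrite notin_setE /= in_itv /= xw'.
Qed.

(** Both sides are product measures, which agree on rectangles. *)
Lemma area_swap (R : realType) (A : set (plane R)) : measurable A ->
  area A = area (unstable.swap @^-1` A).
Proof.
move=> mA; rewrite /area.
rewrite (@product_measure_unique _ _ _ _ R (@lebesgue_measure R)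
  (@lebesgue_measure R)
  (@lebesgue_measure R \x^ @lebesgue_measure R)%E)//; last first.
  by move=> B C mB mC; exact: product_measure2E.
Qed.

Lemma lebesgue_itv_oc (R : realType) (a b : R) : a <= b ->
  lebesgue_measure (`]a, b]%classic : set (measurableTypeR R)) = (b - a)%:E.
Proof.
move=> ab; rewrite lebesgue_measure_itv /= lte_fin; case: ltP => //.
by move=> ba; rewrite (le_anti (introT andP (conj ab ba))) subrr.
Qed.

Lemma lebesgue_itv_co (R : realType) (a b : R) : a <= b ->
  lebesgue_measure (`[a, b[%classic : set (measurableTypeR R)) = (b - a)%:E.
Proof.
move=> ab; rewrite lebesgue_measure_itv /= lte_fin; case: ltP => //.
by move=> ba; rewrite (le_anti (introT andP (conj ab ba))) subrr.
Qed.

Lemma lebesgue_itv_cc (R : realType) (a b : R) : a <= b ->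
  lebesgue_measure (`[a, b]%classic : set (measurableTypeR R)) = (b - a)%:E.
Proof.
move=> ab; rewrite lebesgue_measure_itv /= lte_fin; case: ltP => //.
by move=> ba; rewrite (le_anti (introT andP (conj ab ba))) subrr.
Qed.

(** The map v |-> sqrt (v^2 - x^2) has derivative v / sqrt (v^2 - x^2) >= 1. *)
Lemma sqrt_gap_ge (R : realType) (u v x : R) : 0 <= u -> u <= v ->
    x ^+ 2 <= u ^+ 2 ->
  Num.sqrt (u ^+ 2 - x ^+ 2) + (v - u) <= Num.sqrt (v ^+ 2 - x ^+ 2).
Proof.
move=> u0 uv xu; set s := Num.sqrt (u ^+ 2 - x ^+ 2).
have s0 : 0 <= s by exact: sqrtr_ge0.
have sE : s ^+ 2 = u ^+ 2 - x ^+ 2 by rewrite sqr_sqrtr// subr_ge0.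
have su : s <= u.
  by rewrite -(ler_pXn2r (n := 2))// ?nnegrE// sE lerBlDr lerDl sqr_ge0.
rewrite -[leLHS]ger0_norm; last by rewrite addr_ge0// subr_ge0.
by rewrite -sqrtr_sqr ler_wsqrtr//; nra.
Qed.

Lemma area_strip_ge (R : realType) (r a b sg h1 h2 : R) :
  sg = 1 \/ sg = - 1 -> a <= b -> h1 <= h2 -> h2 <= r ->
  h2 - r <= a -> b <= r - h2 ->
  (((b - a) * (h2 - h1))%:E <= area (strip r a b sg h1 h2))%E.
Proof.
move=> sgE ab h12 h2r har hbr; apply: area_ge_xsection => //.
  by rewrite subr_ge0.
move=> x /andP[ax xb].
have x2 : (x : R) ^+ 2 <= (r - h2) ^+ 2 by nra.
have x1 : (x : R) ^+ 2 <= (r - h1) ^+ 2 by apply: le_trans x2 _; nra.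
pose u := Num.sqrt ((r - h2) ^+ 2 - (x : R) ^+ 2).
pose v := Num.sqrt ((r - h1) ^+ 2 - (x : R) ^+ 2).
have u0 : 0 <= u by exact: sqrtr_ge0.
have v0 : 0 <= v by exact: sqrtr_ge0.
have uE : u ^+ 2 = (r - h2) ^+ 2 - (x : R) ^+ 2 by rewrite sqr_sqrtr// subr_ge0.
have vE : v ^+ 2 = (r - h1) ^+ 2 - (x : R) ^+ 2 by rewrite sqr_sqrtr// subr_ge0.
have uv : u + (h2 - h1) <= v.
  have -> : h2 - h1 = (r - h1) - (r - h2) by ring.
  by apply: sqrt_gap_ge => //; [rewrite subr_ge0|rewrite lerD2l lerN2].
have mS : measurable (xsection (strip r a b sg h1 h2) x).
  by apply: measurable_xsection; exact: measurable_strip.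
have uv' : u <= v by lra.
case: sgE => sgE.
  apply: (@le_trans _ _ (lebesgue_measure (`]u, v]%classic : set
    (measurableTypeR R)))).
    by rewrite lebesgue_itv_oc// lee_fin; lra.
  apply: le_measure; rewrite ?inE//.
  move=> y /=; rewrite in_itv /= => /andP[uy yv].
  rewrite /xsection /= inE /strip /nsq /= sgE mul1r.
  by split; [split; [split|]|]; rewrite ?ax//; nra.
apply: (@le_trans _ _ (lebesgue_measure
  (`[- v, - u[%classic : set (measurableTypeR R)))).
  by rewrite lebesgue_itv_co ?lee_fin; lra.
apply: le_measure; rewrite ?inE//.
move=> y /=; rewrite in_itv /= => /andP[vy yu].
rewrite /xsection /= inE /strip /nsq /= sgE mulN1r.
by split; [split; [split|]|]; rewrite ?ax//; nra.
Qed.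

(** For s > r this is the whole plane, which keeps the bounds below valid for
    every s >= 0. *)
Definition rim (R : realType) (r s : R) : set (plane R) :=
  [set p | r - s <= dist2 (0, 0) p].

Lemma measurable_rim (R : realType) (r s : R) : measurable (rim r s).
Proof.
have [rs|rs] := leP (r - s) 0.
  have -> : rim r s = setT; last exact: measurableT.
  by apply/seteqP; split => p // _; rewrite /rim /= (le_trans rs)// sqrtr_ge0.
have -> : rim r s = ~` [set p | nsq p < (r - s) ^+ 2].
  apply/seteqP; split => p; rewrite /rim /= leNgt (dist2_lt _ _ (ltW rs)) sqd0.
    by move/negP.
  by move/negP.
exact: measurableC (measurable_nsq_lt _).
Qed.

Lemma le_area (R : realType) (A B : set (plane R)) :
  measurable A -> measurable B -> A `<=` B -> (area A <= area B)%E.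
Proof. by move=> mA mB AB; apply: le_measure; rewrite ?inE. Qed.

Lemma area_disc_le (R : realType) (r : R) : 0 < r ->
  (area (disc (0%R, 0%R) r) <= (4 * r ^+ 2)%:E)%E.
Proof.
move=> r0; have -> : 4 * r ^+ 2 = (r + r) * (r + r) by ring.
rewrite (disc0E (ltW r0)).
apply: area_le_xsection; [lra|lra| |].
  move=> p /=; rewrite /nsq => H;
    rewrite -(ler_pXn2r (n := 2))// ?nnegrE ?(ltW r0)//.
  by rewrite real_normK ?num_real//; apply: le_trans H; rewrite lerDl sqr_ge0.
move=> x _.
apply: (@le_trans _ _ (lebesgue_measure
  (`[- r, r]%classic : set (measurableTypeR R)))); last first.
  by rewrite lebesgue_itv_cc ?opprK//; lra.
apply: le_measure; rewrite ?inE//.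
  by apply: measurable_xsection; exact: measurable_nsq_le.
move=> y; rewrite /xsection /= inE /nsq /= in_itv /= => H.
have := sqr_ge0 (x : R) => ?.
by apply/andP; split; nra.
Qed.

Lemma area_disc_ge (R : realType) (r : R) : 0 < r ->
  ((r ^+ 2 / 100)%:E <= area (disc (0%R, 0%R) r))%E.
Proof.
move=> r0; apply: (@le_trans _ _
  (area (strip r (- (r / 2)) (r / 2) 1 0 (r / 2)))).
  apply: (@le_trans _ _ (((r / 2 - - (r / 2)) * (r / 2 - 0))%:E)).
    by rewrite lee_fin; nra.
  by apply: area_strip_ge; [left|lra..].
apply: le_area; [exact: measurable_strip|exact: (measurable_disc0 (ltW r0))|].
by move=> p [[[_ H] _] _]; rewrite (disc0E (ltW r0)) /=; rewrite subr0 in H.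
Qed.

(** Vertical sections of a rim of width s have length O(s) away from the two
    points of the circle with vertical tangent; by symmetry, the part of the rim
    near these points is handled by horizontal sections. *)
Lemma area_band_le (R : realType) (r s : R) : 0 < r -> 0 <= s -> s <= r / 10 ->
  (area ([set p : plane R | (`|p.1 : R| <= 4 / 5 * r)%R] `&`
    (rim r s `&` disc (0%R, 0%R) r)) <= (13 * r * s)%:E)%E.
Proof.
move=> r0 s0 sr.
have rr : 0 <= 4 / 5 * r by lra.
apply: (@le_trans _ _ (((4 / 5 * r + 4 / 5 * r) * (8 * s))%:E)); last first.
  by rewrite lee_fin; nra.
apply: area_le_xsection => //; [lra|by move=> p []|].
move=> x xr.
have x2 : (x : R) ^+ 2 <= (4 / 5 * r) ^+ 2.
  by rewrite -real_normK ?num_real// lerXn2r ?nnegrE.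
pose u := Num.sqrt ((r - s) ^+ 2 - (x : R) ^+ 2).
pose v := Num.sqrt (r ^+ 2 - (x : R) ^+ 2).
have u0 : 0 <= u by exact: sqrtr_ge0.
have v0 : 0 <= v by exact: sqrtr_ge0.
have uE : u ^+ 2 = (r - s) ^+ 2 - (x : R) ^+ 2 by rewrite sqr_sqrtr//; nra.
have vE : v ^+ 2 = r ^+ 2 - (x : R) ^+ 2 by rewrite sqr_sqrtr//; nra.
have vr : 3 / 5 * r <= v by nra.
have uv : u <= v by nra.
have uv4 : v - u <= 4 * s.
  have : (v - u) * v <= 2 * r * s by nra.
  by nra.
have mA : measurable (xsection
  ([set p : plane R | (`|p.1 : R| <= 4 / 5 * r)%R] `&`
    (rim r s `&` disc (0%R, 0%R) r)) x).
  apply: measurable_xsection; apply: measurableI; last first.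
    by apply: measurableI; [exact: measurable_rim|exact:
      (measurable_disc0 (ltW r0))].
  have -> : [set p : plane R | (`|p.1 : R| <= 4 / 5 * r)%R] =
      setT `&` ((fun p : plane R => (p.1 : R)) @^-1`
        `[- (4 / 5 * r), 4 / 5 * r]).
    by rewrite setTI; apply/seteqP; split => p /=; rewrite in_itv/= ler_norml.
  by apply: measurable_fst.
apply: (@le_trans _ _ (lebesgue_measure
  ((`[u, v]%classic : set (measurableTypeR R)) `|` `[- v, - u]))).
  apply: le_measure; rewrite ?inE//; first exact: measurableU.
  move=> y; rewrite /xsection /= inE => -[_ []];
    rewrite (disc0E (ltW r0)) /rim /=.
  rewrite leNgt dist2_lt; last by lra.
  rewrite sqd0 /nsq /= -leNgt !in_itv /= => H1 H2.
  have [y0|y0] := leP 0 (y : R); [left|right]; apply/andP; split; nra.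
apply: (@le_trans _ _ (_ + _)%E).
  by apply: measureU2.
by rewrite /= !lebesgue_itv_cc//; [rewrite -EFinD lee_fin; lra|lra].
Qed.

(** As 2 (4/5)^2 > 1, one of the two coordinates of a point of the disc of
    radius r is at most 4r/5 in absolute value, so that the band with bounded
    abscissa and its mirror image across the diagonal cover the rim. For s >=
    r/10 the area of the whole disc is small enough. *)
Lemma area_rim_le (R : realType) (r s : R) : 0 < r -> 0 <= s ->
  (area (rim r s `&` disc (0%R, 0%R) r) <= (40 * r * s)%:E)%E.
Proof.
move=> r0 s0; have [sr|sr] := leP (r / 10) s.
  apply: (@le_trans _ _ (area (disc (0%R, 0%R) r))).
    apply: le_area; [|exact: (measurable_disc0 (ltW r0))|exact: subIsetr].
    by apply: measurableI; [exact: measurable_rim|exact: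
      (measurable_disc0 (ltW r0))].
  by apply: le_trans (area_disc_le r0) _; rewrite lee_fin; nra.
have mAD : measurable (rim r s `&` disc (0, 0) r).
  by apply: measurableI; [exact: measurable_rim|exact:
    (measurable_disc0 (ltW r0))].
pose B := [set p : plane R | (`|p.1 : R| <= 4 / 5 * r)%R] `&`
  (rim r s `&` disc (0, 0) r).
pose B' := [set p : plane R | `|p.2 : R| <= 4 / 5 * r] `&`
  (rim r s `&` disc (0, 0) r).
have mB : measurable B.
  apply: measurableI => //.
  have -> : [set p : plane R | (`|p.1 : R| <= 4 / 5 * r)%R] =
      setT `&` ((fun p : plane R => (p.1 : R)) @^-1`
        `[- (4 / 5 * r), 4 / 5 * r]).
    by rewrite setTI; apply/seteqP; split => p /=; rewrite in_itv/= ler_norml.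
  by apply: measurable_fst.
have mB' : measurable B'.
  apply: measurableI => //.
  have -> : [set p : plane R | `|p.2 : R| <= 4 / 5 * r] =
      setT `&` ((fun p : plane R => (p.2 : R)) @^-1`
        `[- (4 / 5 * r), 4 / 5 * r]).
    by rewrite setTI; apply/seteqP; split => p /=; rewrite in_itv/= ler_norml.
  by apply: measurable_snd.
apply: (@le_trans _ _ (area (B `|` B'))).
  apply: le_area => //; first exact: measurableU.
  move=> p [pA pD]; have := pD; rewrite (disc0E (ltW r0)) /= /nsq => H.
  have [x1|x1] := leP `|p.1 : R| (4 / 5 * r); [by left|right; split => //=].
  rewrite leNgt; apply/negP => x2.
  have := real_normK (num_real (p.1 : R));
    have := real_normK (num_real (p.2 : R)).
  by nra.
apply: (@le_trans _ _ (area B + area B')%E); first by apply: measureU2.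
have -> : area B' = area B.
  rewrite (area_swap mB'); congr area; apply/seteqP.
  have swapE (p : plane R) : dist2 (0, 0) (unstable.swap p) = dist2 (0, 0) p.
    by rewrite /dist2 /= addrC.
  by split => p [H1 [H2 H3]]; split => //; split; move: H2 H3;
    rewrite /rim /disc /= swapE.
have B1 : (area B <= (13 * r * s)%:E)%E by apply: area_band_le => //; lra.
apply: (@le_trans _ _ (_ + _)%E); first by apply: leeD; exact: B1.
by rewrite -EFinD lee_fin; nra.
Qed.

(** * Vertices of disc-polygons *)

Lemma dist2_sym (R : realType) (p q : plane R) : dist2 p q = dist2 q p.
Proof. by rewrite /dist2 -sqrrN opprB -[X in _ + X]sqrrN opprB. Qed.

Lemma dist2_ge0 (R : realType) (p q : plane R) : 0 <= dist2 p q.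
Proof. exact: sqrtr_ge0. Qed.

Lemma dist2_sqr (R : realType) (p q : plane R) :
  dist2 p q ^+ 2 = ((p.1 : R) - q.1) ^+ 2 + ((p.2 : R) - q.2) ^+ 2.
Proof. by rewrite sqr_sqrtr// addr_ge0// sqr_ge0. Qed.

(** Squaring reduces this to the Cauchy-Schwarz inequality for the two
    difference vectors. *)
Lemma dist2_triangle (R : realType) (p q m : plane R) :
  dist2 p q <= dist2 p m + dist2 m q.
Proof.
have h1 := dist2_ge0 p m; have h2 := dist2_ge0 m q.
rewrite dist2_le ?addr_ge0// [X in _ <= X]sqrrD !dist2_sqr.
set a := (p.1 : R) - m.1; set b := (p.2 : R) - m.2.
set c := (m.1 : R) - q.1; set e := (m.2 : R) - q.2.
have -> : (p.1 : R) - q.1 = a + c by rewrite /a /c addrA subrK.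
have -> : (p.2 : R) - q.2 = b + e by rewrite /b /e addrA subrK.
have : a * c + b * e <= dist2 p m * dist2 m q.
  apply: (le_trans (ler_norm _)).
  rewrite -(ler_pXn2r (n := 2))// ?nnegrE ?mulr_ge0// real_normK ?num_real//.
  rewrite exprMn !dist2_sqr -/a -/b -/c -/e.
  have := sqr_ge0 (a * e - b * c); nra.
by rewrite -mulr_natl; nra.
Qed.

(** The centres of the discs of radius r containing X; [rhull r X] is the
    intersection of these discs. *)
Definition rdual (R : realType) (r : R) (X : set (plane R)) : set (plane R) :=
  [set c | X `<=` disc c r].

Lemma rhull_sub (R : realType) (r : R) (X : set (plane R)) : X `<=` rhull r X.
Proof. by move=> p Xp c; apply. Qed.

Lemma vertex_rdual (R : realType) (r : R) (X : set (plane R)) p :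
  vertices r (rhull r X) p -> exists2 c, rdual r X c & dist2 c p = r.
Proof.
by case=> _ [c1 [c2 [_ H1 _ E1 _]]]; exists c1 => // q /rhull_sub /H1.
Qed.

Lemma finite_gap (R : realType) (n : nat) (Q : pred 'I_n) (f : 'I_n -> R) :
  (forall i, Q i -> 0 < f i) -> exists2 e : R, 0 < e & forall i, Q i ->
    e <= f i.
Proof.
move=> f0; exists (\big[Num.min/1]_(i | Q i) f i).
  by apply: lt_bigmin.
by move=> i Qi; apply: bigmin_le_cond.
Qed.

(** Suppose that p is on the boundary of two discs containing the points x_i
    and that no x_i is p.  Put v_i = x_i - p and w = (c1 - p) + (c2 - p).
    Adding the two inequalities |x_i - c_j| <= r gives |v_i|^2 <= <v_i, w>, and
    |w| < 2r as c1 <> c2.  Hence with c = p + s w one has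
      |x_i - c|^2 <= s^2 |w|^2 - (2s - 1) |v_i|^2.
    When s |w| = r we have s > 1/2, and the finitely many |v_i| are bounded away
    from 0; so s can be taken slightly larger, which leaves p outside of a disc
    of radius r that contains all the x_i. *)
Lemma vertices_sub (R : realType) (r : R) (n : nat) (x : 'I_n -> plane R) p :
  0 < r -> (0 < n)%N -> vertices r (rhull r (range x)) p -> exists i, p = x i.
Proof.
move=> r0 n0 [Sp [c1 [c2 [c12 S1 S2 E1 E2]]]]; apply: contrapT => pX.
have X1 i : dist2 c1 (x i) <= r by apply: S1; apply: rhull_sub; exists i.
have X2 i : dist2 c2 (x i) <= r by apply: S2; apply: rhull_sub; exists i.
pose v1 i := ((x i).1 : R) - p.1; pose v2 i := ((x i).2 : R) - p.2.
pose w1 := ((c1.1 : R) - p.1) + ((c2.1 : R) - p.1).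
pose w2 := ((c1.2 : R) - p.2) + ((c2.2 : R) - p.2).
have vw i : v1 i ^+ 2 + v2 i ^+ 2 <= v1 i * w1 + v2 i * w2.
  move: (X1 i) (X2 i) (dist2_sqr c1 p) (dist2_sqr c2 p).
  rewrite !(dist2_le _ _ (ltW r0)) E1 E2 /v1 /v2 /w1 /w2; nra.
have v0 i : 0 < v1 i ^+ 2 + v2 i ^+ 2.
  rewrite lt_neqAle addr_ge0 ?sqr_ge0// andbT eq_sym paddr_eq0 ?sqr_ge0//
    !sqrf_eq0.
  apply/negP => /andP[]; rewrite !subr_eq0 => /eqP e1 /eqP e2.
  apply: pX; exists i; move: e1 e2; case: (x i) => a b /=;
    case: (p) => a' b' /=.
  by move=> -> ->.
pose W := w1 ^+ 2 + w2 ^+ 2.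
have Wr : W < 4 * r ^+ 2.
  have : 0 < ((c1.1 : R) - c2.1) ^+ 2 + ((c1.2 : R) - c2.2) ^+ 2.
    rewrite lt_neqAle addr_ge0 ?sqr_ge0// andbT eq_sym paddr_eq0 ?sqr_ge0//
      !sqrf_eq0.
    apply/negP => /andP[]; rewrite !subr_eq0 => /eqP e1 /eqP e2.
    apply: c12; move: e1 e2; case: (c1) => a b /=; case: (c2) => a' b' /=.
    by move=> -> ->.
  move: (dist2_sqr c1 p) (dist2_sqr c2 p); rewrite E1 E2 /W /w1 /w2; nra.
have W0 : 0 < W.
  rewrite lt_neqAle addr_ge0 ?sqr_ge0// andbT eq_sym paddr_eq0 ?sqr_ge0//
    !sqrf_eq0.
  apply/negP => /andP[/eqP e1 /eqP e2].
  have := vw (Ordinal n0); rewrite e1 e2 !mulr0 addr0 leNgt.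
  by rewrite v0.
have [m m0 mv] := @finite_gap R n predT (fun i => v1 i ^+ 2 + v2 i ^+ 2)
  (fun i _ => v0 i).
pose s0 := r / Num.sqrt W.
have sW0 : 0 < Num.sqrt W by rewrite sqrtr_gt0.
have s0W : s0 ^+ 2 * W = r ^+ 2.
  by rewrite /s0 expr_div_n sqr_sqrtr ?ltW// mulfVK// gt_eqF.
have s00 : 0 < s0 by rewrite divr_gt0.
have s04 : 1 < 4 * s0 ^+ 2 by rewrite -(ltr_pM2r W0) -mulrA s0W mul1r.
have s0h : 1 < 2 * s0 by clear - s04 s00; nra.
(* the amount by which s^2 |w|^2 may exceed r^2 *)
pose eta := (2 * s0 - 1) * m.
have eta0 : 0 < eta by rewrite mulr_gt0// subr_gt0.
pose s := Num.sqrt (s0 ^+ 2 + eta / W).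
have sE : s ^+ 2 * W = r ^+ 2 + eta.
  rewrite sqr_sqrtr; last by rewrite addr_ge0 ?sqr_ge0 ?divr_ge0// ltW.
  by rewrite mulrDl s0W mulfVK// gt_eqF.
have sW : 0 <= s by exact: sqrtr_ge0.
have ss0 : s0 <= s.
  rewrite -(ler_pXn2r (n := 2))// ?nnegrE ?(ltW s00)//.
  rewrite -(ler_pM2r W0) sE s0W; lra.
pose c : plane R := (p.1 + s * w1, p.2 + s * w2).
have cX : range x `<=` disc c r.
  move=> _ [i _ <-]; rewrite /disc /= (dist2_le _ _ (ltW r0)).
  have -> : c.1 - (x i).1 = s * w1 - v1 i by rewrite /c /v1 /=; ring.
  have -> : c.2 - (x i).2 = s * w2 - v2 i by rewrite /c /v2 /=; ring.
  have := vw i; have := mv i isT; rewrite /= => h1 h2.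
  have : (2 * s0 - 1) * m <= (2 * s - 1) * (v1 i ^+ 2 + v2 i ^+ 2) by nra.
  move: sE; rewrite /W /eta; nra.
have := Sp c cX; rewrite /disc /= (dist2_le _ _ (ltW r0)).
have -> : c.1 - p.1 = s * w1 by rewrite /c /=; ring.
have -> : c.2 - p.2 = s * w2 by rewrite /c /=; ring.
move: sE; rewrite /W; nra.
Qed.

(** The strict inequalities persist when c is slightly rotated about x_i, and
    this gives the second disc required by the definition of a vertex. *)
Lemma vertex_of_support (R : realType) (r : R) (n : nat) (x : 'I_n ->
    plane R) i c :
  0 < r -> dist2 c (x i) = r -> (forall l, l != i -> dist2 c (x l) < r) ->
  vertices r (rhull r (range x)) (x i).
Proof.
move=> r0 ci cl; split; first by apply: rhull_sub; exists i.
have [e e0 He] := @finite_gap R n (fun l => l != i) (fun l => r - dist2 c (x l))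
  (fun l li => ltac:(rewrite subr_gt0; exact: cl)).
pose t := e / (2 * r).
have t0 : 0 < t by rewrite divr_gt0// mulr_gt0.
have tr : 2 * t * r = e by rewrite /t; field; rewrite gt_eqF.
pose d1 := (c.1 : R) - (x i).1; pose d2 := (c.2 : R) - (x i).2.
have dr : d1 ^+ 2 + d2 ^+ 2 = r ^+ 2 by rewrite -ci dist2_sqr.
have T0 : 1 + t ^+ 2 != 0 by rewrite gt_eqF// ltr_pwDl// sqr_ge0.
(* the rotation of c - x_i by the angle 2 arctan t, which moves it by at most
   2 t r = e *)
pose g1 := ((1 - t ^+ 2) * d1 - 2 * t * d2) / (1 + t ^+ 2).
pose g2 := ((1 - t ^+ 2) * d2 + 2 * t * d1) / (1 + t ^+ 2).
have gr : g1 ^+ 2 + g2 ^+ 2 = r ^+ 2.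
  by rewrite -dr /g1 /g2; field.
have gd : (g1 - d1) ^+ 2 + (g2 - d2) ^+ 2 = 4 * t ^+ 2 * r ^+ 2 / (1 + t ^+ 2).
  by rewrite -dr /g1 /g2; field.
pose c' : plane R := ((x i).1 + g1, (x i).2 + g2).
have cc' : dist2 c' c <= e.
  rewrite (dist2_le _ _ (ltW e0)).
  have -> : c'.1 - c.1 = g1 - d1 by rewrite /c' /d1 /=; ring.
  have -> : c'.2 - c.2 = g2 - d2 by rewrite /c' /d2 /=; ring.
  rewrite gd -tr ler_pdivrMr; last by rewrite ltr_pwDl// sqr_ge0.
  have := sqr_ge0 (t * r * t); nra.
have c'i : dist2 c' (x i) = r.
  apply/eqP; rewrite (dist2_eq _ _ (ltW r0)).
  have -> : c'.1 - (x i).1 = g1 by rewrite /c' /=; ring.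
  have -> : c'.2 - (x i).2 = g2 by rewrite /c' /=; ring.
  by rewrite gr.
have rdualE b : (forall l, dist2 b (x l) <= r) ->
  rhull r (range x) `<=` disc b r.
  by move=> H p; apply => _ [l _ <-]; exact: H.
exists c', c; split => //.
- move=> cE; have : 4 * t ^+ 2 * r ^+ 2 / (1 + t ^+ 2) = 0.
    rewrite -gd; have -> : g1 = d1 by rewrite /d1 -cE /c' /=; ring.
    have -> : g2 = d2 by rewrite /d2 -cE /c' /=; ring.
    by rewrite !subrr expr0n addr0.
  move=> E0; suff : 0 < 4 * t ^+ 2 * r ^+ 2 / (1 + t ^+ 2) by rewrite E0 ltxx.
  apply: divr_gt0; last by rewrite ltr_pwDl// sqr_ge0.
  by apply: mulr_gt0; [apply: mulr_gt0 => //|]; exact: exprn_gt0.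
- apply: rdualE => l; have [->|li] := eqVneq l i; first by rewrite c'i.
  apply: le_trans (dist2_triangle _ _ c) _; have := He l li; lra.
- apply: rdualE => l; have [->|li] := eqVneq l i; first by rewrite ci.
  exact/ltW/cl.
Qed.

Lemma f0_le (R : realType) (r : R) (n : nat) (x : 'I_n -> plane R)
    (B : pred 'I_n) :
  0 < r -> (0 < n)%N ->
  (forall i, vertices r (rhull r (range x)) (x i) -> B i) ->
  (f0 r (rhull r (range x)) <= #|B|)%N.
Proof.
move=> r0 n0 VB; have Vx := @vertices_sub R r n x _ r0 n0.
have finV : finite_set (vertices r (rhull r (range x))).
  apply: (@sub_finite_set _ _ (range x)); last exact/finite_image/finite_finset.
  by move=> p /Vx[i ->]; exists i.
rewrite /f0 cardE -(size_map x); apply: uniq_leq_size; first exact: fset_uniq.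
move=> p; rewrite in_fset_set// inE => Vp; have [i pi] := Vx _ Vp.
by rewrite pi; apply: map_f; rewrite mem_enum; apply: VB; rewrite -pi.
Qed.

Lemma f0_ge (R : realType) (r : R) (n m : nat) (x : 'I_n -> plane R)
    (f : 'I_m -> 'I_n) :
  0 < r -> (0 < n)%N -> injective (fun j => x (f j)) ->
  (forall j, vertices r (rhull r (range x)) (x (f j))) ->
  (m <= f0 r (rhull r (range x)))%N.
Proof.
move=> r0 n0 xf V; have Vx := @vertices_sub R r n x _ r0 n0.
have finV : finite_set (vertices r (rhull r (range x))).
  apply: (@sub_finite_set _ _ (range x)); last exact/finite_image/finite_finset.
  by move=> p /Vx[i ->]; exists i.
rewrite -[leqLHS]card_ord cardE -(size_map (fun j => x (f j))).
apply: uniq_leq_size; first by rewrite map_inj_uniq// enum_uniq.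
by move=> _ /mapP[j _ ->]; rewrite in_fset_set// inE.
Qed.

(** A vertex is at distance r from a point c of the r-dual, and |c| <= s. *)
Lemma vertex_in_rim (R : realType) (r s : R) (X : set (plane R)) p :
  rdual r X `<=` disc (0, 0) s -> vertices r (rhull r X) p -> rim r s p.
Proof.
move=> Xs /vertex_rdual[c /Xs]; rewrite /rim /disc /= => cs <-.
rewrite lerBlDr addrC; apply: le_trans (dist2_triangle _ _ (0, 0)) _.
by rewrite lerD2r dist2_sym.
Qed.

Lemma disc_sub_rhull (R : realType) (r s : R) (X : set (plane R)) :
  rdual r X `<=` disc (0, 0) s -> ~` (rim r s) `<=` rhull r X.
Proof.
move=> Xs p; rewrite /rim /= => /negP; rewrite -ltNge => ps c /Xs cs.
rewrite /disc /=; apply: le_trans (dist2_triangle _ _ (0, 0)) _.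
by move: cs; rewrite /disc /= dist2_sym; lra.
Qed.

Lemma rhull_sub_disc (R : realType) (r : R) (X : set (plane R)) :
  X `<=` disc (0, 0) r -> rhull r X `<=` disc (0, 0) r.
Proof. by move=> Xr p; apply. Qed.

(** This crude bound is the one used when even deep strips are missed. *)
Lemma rdual_sub_disc2 (R : realType) (r : R) (X : set (plane R)) :
  X `<=` disc (0, 0) r -> X !=set0 -> rdual r X `<=` disc (0, 0) (2 * r).
Proof.
move=> Xr [p Xp] c /(_ _ Xp); have := Xr _ Xp; rewrite /disc /= => h1 h2.
apply: le_trans (dist2_triangle _ _ p) _; rewrite (dist2_sym p c); lra.
Qed.

(** * Strips that pin down the disc-polygon *)

Lemma stripP (R : realType) (r a b sg h1 h2 : R) p :
  strip r a b sg h1 h2 p ->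
  [/\ (r - h2) ^+ 2 < nsq p, nsq p <= (r - h1) ^+ 2, a <= (p.1 : R),
     (p.1 : R) <= b & 0 < sg * (p.2 : R)].
Proof. by move=> [[[? ?] /andP[? ?]] ?]; split. Qed.

Lemma strip_sub_rim (R : realType) (r a b sg h1 h2 s : R) : h2 <= r ->
    h2 <= s ->
  strip r a b sg h1 h2 `<=` rim r s.
Proof.
move=> h2r h2s p /stripP[H _ _ _ _]; rewrite /rim /= leNgt; apply/negP => H'.
have rs0 : 0 <= r - s by apply: le_trans (ltW H'); exact: dist2_ge0.
move: H'; rewrite (dist2_lt _ _ rs0) sqd0 => H'.
by have := lt_trans H H';
  rewrite ltNge lerXn2r ?nnegrE ?lerD2l ?lerN2// subr_ge0.
Qed.

(** Three strips near the directions (0, 1), (3/4, - 2/3) and (- 3/4, - 2/3). *)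
Definition tri_strip (R : realType) (r h : R) (j : 'I_3) : set (plane R) :=
  if j == 0 :> nat then strip r (- (r / 10)) (r / 10) 1 0 h
  else if j == 1 :> nat then strip r (7 / 10 * r) (8 / 10 * r) (-1) 0 h
  else strip r (- (8 / 10 * r)) (- (7 / 10 * r)) (-1) 0 h.

(** Every vector c = (u, v) makes an angle bounded away from a right angle, and
    obtuse, with some point of one of the three strips: the point at the top if
    c points steeply downwards, and otherwise the point at the bottom on the
    side opposite to c. *)
Lemma tri_cover (R : realType) (r u v x1 y1 x2 y2 x3 y3 : R) : 0 < r ->
  - (r / 10) <= x1 -> x1 <= r / 10 -> 8 / 10 * r <= y1 ->
  7 / 10 * r <= x2 -> y2 <= - (4 / 10 * r) -> - (72 / 100 * r) <= y2 ->
  x3 <= - (7 / 10 * r) -> y3 <= - (4 / 10 * r) -> - (72 / 100 * r) <= y3 ->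
  [\/ r * (`|u| + `|v|) <= - 5 * (u * x1 + v * y1),
      r * (`|u| + `|v|) <= - 5 * (u * x2 + v * y2) |
      r * (`|u| + `|v|) <= - 5 * (u * x3 + v * y3)].
Proof.
move=> r0 a1 b1 c1 a2 b2 c2 a3 b3 c3.
have [v0|v0] := leP 0 v; have [u0|u0] := leP 0 u;
  rewrite ?(ger0_norm v0) ?(ger0_norm u0) ?(ltr0_norm v0) ?(ltr0_norm u0).
- by apply: Or33; nra.
- by apply: Or32; nra.
- have [uv|uv] := leP u (- 2 * v); first by apply: Or31; nra.
  by apply: Or33; nra.
- have [uv|uv] := leP (- u) (- 2 * v); first by apply: Or31; nra.
  by apply: Or32; nra.
Qed.

(** If c is in the r-dual and p in a strip, then |c - p| <= r and |p| > r - h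
    give |c|^2 - 2 <c, p> <= 2 r h. For the p provided by [tri_cover] the term -
    2 <c, p> is at least 2/5 r (|u| + |v|), whence |u| + |v| <= 5h. The weaker
    radius 20h is chosen because it equals 2r, a bound which always holds, at
    the largest depth h = r/10. *)
Lemma rdual_tri (R : realType) (r h : R) (X : set (plane R)) :
  0 < r -> 0 <= h -> h <= r / 10 -> (forall j, X `&` tri_strip r h j !=set0) ->
  rdual r X `<=` disc (0, 0) (20 * h).
Proof.
move=> r0 h0 hr Xtri c Xc.
have key p : X p -> (r - h) ^+ 2 < nsq p ->
    nsq c - 2 * ((c.1 : R) * p.1 + (c.2 : R) * p.2) <= 2 * r * h.
  move=> /Xc; rewrite /disc /= (dist2_le _ _ (ltW r0)) /nsq; nra.
have [p1 [Xp1 /stripP[A1 _ C1 D1 E1]]] := Xtri (@Ordinal 3 0 isT).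
have [p2 [Xp2 /stripP[A2 B2 C2 D2 E2]]] := Xtri (@Ordinal 3 1 isT).
have [p3 [Xp3 /stripP[A3 B3 C3 D3 E3]]] := Xtri (@Ordinal 3 2 isT).
have {Xp1}K1 := key _ Xp1 A1; have {Xp2}K2 := key _ Xp2 A2.
have {Xp3}K3 := key _ Xp3 A3.
move: A1 A2 A3 B2 B3 E1 E2 E3; rewrite /nsq !subr0 mul1r !mulN1r !oppr_gt0.
set x1 : R := p1.1 in C1 D1 K1 *; set y1 : R := p1.2 in K1 *.
set x2 : R := p2.1 in C2 D2 K2 *; set y2 : R := p2.2 in K2 *.
set x3 : R := p3.1 in C3 D3 K3 *; set y3 : R := p3.2 in K3 *.
move=> A1 A2 A3 B2 B3 E1 E2 E3.
have rh : (9 / 10 * r) ^+ 2 <= (r - h) ^+ 2 by nra.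
have y1r : 8 / 10 * r <= y1 by nra.
have y2r : y2 <= - (4 / 10 * r) by nra.
have y2r' : - (72 / 100 * r) <= y2 by nra.
have y3r : y3 <= - (4 / 10 * r) by nra.
have y3r' : - (72 / 100 * r) <= y3 by nra.
have uv0 : 0 <= `|c.1 : R| + `|c.2 : R| by rewrite addr_ge0.
have c2 : nsq c <= (`|c.1 : R| + `|c.2 : R|) ^+ 2.
  rewrite /nsq sqrrD !real_normK ?num_real// -mulr_natl.
  have : 0 <= `|c.1 : R| * `|c.2 : R| by rewrite mulr_ge0.
  lra.
have c0 := nsq_ge0 c.
rewrite disc0E; last by lra.
suff : `|c.1 : R| + `|c.2 : R| <= 5 * h by rewrite /=; nra.
rewrite -(ler_pM2l r0).
have := @tri_cover R r c.1 c.2 x1 y1 x2 y2 x3 y3 r0 C1 D1 y1r C2 y2r y2r' D3 y3r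
  y3r'.
by clear - K1 K2 K3 c0; case=> H; lra.
Qed.

Definition quad_sx (R : realType) (j : 'I_4) : R := if (j < 2)%N then 1 else -1.

Definition quad_sy (R : realType) (j : 'I_4) : R := if odd j then -1 else 1.

(** Four strips near the diagonals, one in each quadrant, at depth between h/2
    and h: the lower bound on the depth is what prevents one of the four points
    from hiding another one. *)
Definition quad_strip (R : realType) (r h : R) (j : 'I_4) : set (plane R) :=
  if (j < 2)%N then strip r (70 / 100 * r) (71 / 100 * r) (quad_sy R j)
    (h / 2) h
  else strip r (- (71 / 100 * r)) (- (70 / 100 * r)) (quad_sy R j) (h / 2) h.

Lemma quadP (R : realType) (r h : R) j p : 0 < r -> 0 <= h -> h <= r / 10 ->
    quad_strip r h j p ->
  exists A B : R, [/\ (p.1 : R) = quad_sx R j * A, (p.2 : R) = quad_sy R j * B,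
     70 / 100 * r <= A <= 71 / 100 * r, 55 / 100 * r <= B <= 715 / 1000 * r &
     (r - h) ^+ 2 < nsq p <= (r - h / 2) ^+ 2].
Proof.
move=> r0 h0 hr Q.
exists (quad_sx R j * (p.1 : R)), (quad_sy R j * (p.2 : R)).
have sx2 : quad_sx R j * quad_sx R j = 1.
  by rewrite /quad_sx; case: ifP => _; rewrite ?mulr1 ?mulrNN ?mulr1.
have sy2 : quad_sy R j * quad_sy R j = 1.
  by rewrite /quad_sy; case: ifP => _; rewrite ?mulr1 ?mulrNN ?mulr1.
rewrite !mulrA sx2 sy2 !mul1r.
have [A1 A2 A3 A4] : [/\ (r - h) ^+ 2 < nsq p, nsq p <= (r - h / 2) ^+ 2,
    70 / 100 * r <= quad_sx R j * (p.1 : R) <= 71 / 100 * r & 0 < quad_sy R j *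
      (p.2 : R)].
  move: Q; rewrite /quad_strip /quad_sx; case: ifP => _ /stripP[? ? h1 h2 ?];
    split => //.
    by rewrite mul1r h1 h2.
  by rewrite mulN1r; apply/andP; split; lra.
rewrite A1 A2 A3; split => //.
move: A1 A2 A3 A4; rewrite /nsq.
have -> : (p.1 : R) ^+ 2 = (quad_sx R j * (p.1 : R)) ^+ 2.
  by rewrite exprMn [in RHS]expr2 sx2 mul1r.
have -> : (p.2 : R) ^+ 2 = (quad_sy R j * (p.2 : R)) ^+ 2.
  by rewrite exprMn [in RHS]expr2 sy2 mul1r.
move: (quad_sx R j * _) (quad_sy R j * _) => A B A1 A2 /andP[A3 A3'] A4.
have rh : (9 / 10 * r) ^+ 2 <= (r - h) ^+ 2 by nra.
by apply/andP; split; nra.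
Qed.

Lemma mul_bounds (R : realType) (lo hi r A A' : R) : 0 <= lo -> 0 <= r ->
  lo * r <= A <= hi * r -> lo * r <= A' <= hi * r ->
  lo ^+ 2 * r ^+ 2 <= A * A' <= hi ^+ 2 * r ^+ 2.
Proof.
move=> lo0 r0 /andP[A1 A2] /andP[A1' A2'].
have lor : 0 <= lo * r by rewrite mulr_ge0.
have A0 := le_trans lor A1; have A0' := le_trans lor A1'.
by rewrite -!exprMn !expr2; apply/andP; split; apply: ler_pM.
Qed.

(** Points of different strips are nearly orthogonal or make an obtuse angle. *)
Lemma quad_dot (R : realType) (r h : R) i j p q : 0 < r -> 0 <= h ->
    h <= r / 10 ->
  i != j -> quad_strip r h i p -> quad_strip r h j q ->
  (p.1 : R) * q.1 + (p.2 : R) * q.2 <= 21 / 100 * r ^+ 2.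
Proof.
move=> r0 h0 hr ij /(quadP r0 h0 hr)[A [B [-> -> bA bB _]]].
move=> /(quadP r0 h0 hr)[A' [B' [-> -> bA' bB' _]]].
have := mul_bounds (divr_ge0 (ler0n R 70) (ler0n R 100)) (ltW r0) bA bA'.
have := mul_bounds (divr_ge0 (ler0n R 55) (ler0n R 100)) (ltW r0) bB bB'.
have := sqr_ge0 r; rewrite (mulrACA _ A) (mulrACA _ B).
move: (r ^+ 2) (A * A') (B * B');
  clear - ij => r2 AA BB r20 /andP[b1 b2] /andP[a1 a2].
move: ij; rewrite /quad_sx /quad_sy.
by case: i => [[|[|[|[|//]]]] ?]; case: j => [[|[|[|[|//]]]] ?] //= _; lra.
Qed.

Lemma quad_sub_rim (R : realType) (r h : R) j : 0 <= h -> h <= r / 10 ->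
  quad_strip r h j `<=` rim r (20 * h).
Proof. by move=> h0 hr; rewrite /quad_strip; case: ifP => _;
  apply: strip_sub_rim; lra. Qed.

Lemma tri_sub_rim (R : realType) (r h : R) j : 0 <= h -> h <= r / 10 ->
  tri_strip r h j `<=` rim r (20 * h).
Proof.
by move=> h0 hr; rewrite /tri_strip; do 2?[case: ifP => _];
  apply: strip_sub_rim; lra.
Qed.

Lemma quad_inj (R : realType) (r h : R) i j p : 0 < r -> 0 <= h ->
    h <= r / 10 ->
  quad_strip r h i p -> quad_strip r h j p -> i = j.
Proof.
move=> r0 h0 hr Qi Qj; apply/eqP; apply: contraT => ij.
have := quad_dot r0 h0 hr ij Qi Qj.
have [_ [_ [_ _ _ _ /andP[]]]] := quadP r0 h0 hr Qi; rewrite /nsq.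
nra.
Qed.

Lemma tri_inj (R : realType) (r h : R) i j p : 0 < r ->
  tri_strip r h i p -> tri_strip r h j p -> i = j.
Proof.
move=> r0; rewrite /tri_strip.
case: i => [[|[|[|//]]] ?]; case: j => [[|[|[|//]]] ?] /=;
  move=> /stripP[_ _ ? ? ?] /stripP[_ _ ? ? ?];
    first [exact: val_inj|exfalso; lra].
Qed.

(** For p = x_(f j), the disc of radius r tangent at p to the circle of radius
    |p| about the origin has centre c = - eta p with |c| = r - |p| < h. A point
    at distance less than r - 20h from the origin is inside it. For a point q of
    another strip, <p, q> is small by [quad_dot] and |q| <= r - h/2, so that |c
    - q|^2 = |q|^2 + 2 eta <p, q> + |c|^2 < r^2. *)
Lemma quad_vertex (R : realType) (r h : R) (n : nat) (x : 'I_n -> plane R)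
    (f : 'I_4 -> 'I_n) j :
  0 < r -> 0 < h -> h <= r / 10 ->
  (forall j, quad_strip r h j (x (f j))) ->
  (forall l, (forall j, f j != l) -> ~ rim r (20 * h) (x l)) ->
  vertices r (rhull r (range x)) (x (f j)).
Proof.
move=> r0 h0 hr Qf Qo; set p := x (f j).
have Qp : quad_strip r h j p by exact: Qf.
have [_ [_ [_ _ _ _ /andP[P1 P2]]]] := quadP r0 (ltW h0) hr Qp.
pose rho := Num.sqrt (nsq p).
have rho2 : rho ^+ 2 = nsq p by rewrite sqr_sqrtr// nsq_ge0.
have rho0 : 0 <= rho by exact: sqrtr_ge0.
have rho1 : r - h < rho.
  by rewrite -(ltr_pXn2r (n := 2))// ?nnegrE ?rho2//; lra.
have rho1' : rho <= r - h / 2.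
  by rewrite -(ler_pXn2r (n := 2))// ?nnegrE ?rho2//; lra.
have rhop : 0 < rho by lra.
pose eta := r / rho - 1.
have etaE : eta * rho = r - rho by rewrite /eta; field; rewrite gt_eqF.
have eta0 : 0 < eta by rewrite subr_gt0 ltr_pdivlMr// mul1r; lra.
pose c : plane R := (- eta * p.1, - eta * p.2).
have c0 : dist2 c (0, 0) < h.
  rewrite (dist2_lt _ _ (ltW h0)) /c /= !subr0 !mulNr !sqrrN !exprMn -mulrDr.
  rewrite -/(nsq p) -rho2 -exprMn etaE; nra.
apply: (vertex_of_support (c := c)) => //.
  apply/eqP; rewrite (dist2_eq _ _ (ltW r0)) /c /= -/p.
  have -> : r = (1 + eta) * rho by rewrite mulrDl etaE; ring.
  by rewrite [X in _ == X]exprMn rho2 /nsq; apply/eqP; ring.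
move=> l lj.
have [[j' fj']|lf] := pselect (exists j', f j' = l); last first.
  have /negP := Qo l (fun j' => ltac:(by apply/eqP => e; apply: lf; exists j')).
  rewrite /rim /= -ltNge => xl.
  apply: le_lt_trans (dist2_triangle _ _ (0, 0)) _; lra.
have jj' : j != j' by apply: contraNneq lj => ->; rewrite fj'.
have Qq : quad_strip r h j' (x l) by rewrite -fj'.
have D := quad_dot r0 (ltW h0) hr jj' Qp Qq.
have [_ [_ [_ _ _ _ /andP[_ P4]]]] := quadP r0 (ltW h0) hr Qq.
rewrite (dist2_lt _ _ (ltW r0)) /c /=.
have -> : (- eta * p.1 - (x l).1) ^+ 2 + (- eta * p.2 - (x l).2) ^+ 2 =
   (eta * rho) ^+ 2 + nsq (x l) + 2 * eta *
     ((p.1 : R) * (x l).1 + (p.2 : R) * (x l).2).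
  by rewrite exprMn rho2 /nsq; ring.
have etar : eta * r <= 112 / 100 * h.
  have : eta * (9 / 10 * r) <= eta * rho by rewrite ler_wpM2l// ?(ltW eta0)//;
    lra.
  rewrite etaE; lra.
have eD : eta * ((p.1 : R) * (x l).1 + (p.2 : R) * (x l).2) <=
  21 / 100 * (112 / 100 * h) * r.
  have : eta * ((p.1 : R) * (x l).1 + (p.2 : R) * (x l).2) <=
    eta * (21 / 100 * r ^+ 2).
    by rewrite ler_wpM2l// (ltW eta0).
  move=> /le_trans; apply; nra.
rewrite etaE; nra.
Qed.

Lemma quad_f0_ge (R : realType) (r h : R) (n : nat) (x : 'I_n -> plane R)
    (f : 'I_4 -> 'I_n) :
  0 < r -> 0 < h -> h <= r / 10 ->
  (forall j, quad_strip r h j (x (f j))) ->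
  (forall l, (forall j, f j != l) -> ~ rim r (20 * h) (x l)) ->
  (4 <= f0 r (rhull r (range x)))%N.
Proof.
move=> r0 h0 hr Qf Qo; apply: (@f0_ge R r n 4 x f) => //.
- by apply: leq_ltn_trans (ltn_ord (f ord0)).
- by move=> i j /= e; apply: (quad_inj r0 (ltW h0) hr (Qf i)); rewrite e;
  exact: Qf.
- by move=> j; exact: (quad_vertex (h := h)).
Qed.

(** The three points confine the r-dual to the disc of radius 20h, so that no
    point off the rim of width 20h is a vertex. *)
Lemma tri_f0_le (R : realType) (r h : R) (n : nat) (x : 'I_n -> plane R)
    (f : 'I_3 -> 'I_n) :
  0 < r -> 0 <= h -> h <= r / 10 ->
  (forall j, tri_strip r h j (x (f j))) ->
  (forall l, (forall j, f j != l) -> ~ rim r (20 * h) (x l)) ->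
  (f0 r (rhull r (range x)) <= 3)%N.
Proof.
move=> r0 h0 hr Qf Qo.
have n0 : (0 < n)%N by apply: leq_ltn_trans (ltn_ord (f ord0)).
have pol : rdual r (range x) `<=` disc (0, 0) (20 * h).
  by apply: rdual_tri => // j; exists (x (f j)); split => //; exists (f j).
apply: (@leq_trans #|[pred l | l \in codom f]|); last first.
  by apply: leq_trans (card_size _) _; rewrite size_codom card_ord.
apply: f0_le => // l /(vertex_in_rim pol) xl; rewrite inE.
apply: contraT => lf; exfalso; apply: (Qo l) => // j.
by apply: contraNneq lf => <-; exact: codom_f.
Qed.

(** * The uniform law on the disc *)

Definition unif (R : realType) (r : R) (B : set (plane R)) : R :=
  fine (area (B `&` disc (0, 0) r)) / fine (area (disc (0, 0) r)).

Lemma area_sub_fin (R : realType) (r : R) (B : set (plane R)) : 0 < r ->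
  measurable B -> area (B `&` disc (0, 0) r) \is a fin_num.
Proof.
move=> r0 mB; have mK := measurable_disc0 (ltW r0).
rewrite ge0_fin_numE; last exact: measure_ge0.
apply: (@le_lt_trans _ _ (area (disc (0, 0) r))).
  by apply: le_area => //; first exact: measurableI.
by apply: le_lt_trans (area_disc_le r0) (ltry _).
Qed.

Lemma area_disc_fin (R : realType) (r : R) : 0 < r ->
  area (disc (0, 0) r) \is a fin_num.
Proof. by move=> r0; have := area_sub_fin r0 measurableT; rewrite setTI. Qed.

Lemma fine_area_disc (R : realType) (r : R) : 0 < r ->
  r ^+ 2 / 100 <= fine (area (disc (0, 0) r)) <= 4 * r ^+ 2.
Proof.
move=> r0; rewrite -!lee_fin fineK; last exact: area_disc_fin.
by rewrite area_disc_ge// area_disc_le.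
Qed.

Lemma fine_area_disc_gt0 (R : realType) (r : R) : 0 < r ->
  0 < fine (area (disc (0, 0) r)).
Proof.
move=> r0; have /andP[+ _] := fine_area_disc r0; apply: lt_le_trans.
by rewrite divr_gt0// exprn_gt0.
Qed.

Lemma unif_ge0 (R : realType) (r : R) (B : set (plane R)) : 0 <= unif r B.
Proof. by rewrite /unif divr_ge0// fine_ge0//; exact: measure_ge0. Qed.

Lemma fine_area_split (R : realType) (r : R) (B : set (plane R)) : 0 < r ->
    measurable B ->
  fine (area (disc (0, 0) r)) =
  fine (area (B `&` disc (0, 0) r)) + fine (area (~` B `&` disc (0, 0) r)).
Proof.
move=> r0 mB; have mK := measurable_disc0 (ltW r0); have mBC := measurableC mB.
rewrite -(fineD (area_sub_fin r0 mB) (area_sub_fin r0 mBC)); congr fine.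
rewrite -[X in area X](setTI (disc (0, 0) r)) -(setUv B) setIUl.
rewrite /area measureU; first by [].
- exact: measurableI.
- exact: measurableI.
- by rewrite setIACA setICr set0I.
Qed.

Lemma unifC (R : realType) (r : R) (B : set (plane R)) : 0 < r ->
    measurable B ->
  unif r (~` B) = 1 - unif r B.
Proof.
move=> r0 mB; have := fine_area_disc_gt0 r0;
  rewrite /unif (fine_area_split r0 mB).
move: (fine _) (fine _) => x y xy0.
by field; rewrite gt_eqF.
Qed.

Lemma unif_le1 (R : realType) (r : R) (B : set (plane R)) : 0 < r ->
    measurable B ->
  unif r B <= 1.
Proof. by move=> r0 mB; rewrite -subr_ge0 -unifC// unif_ge0. Qed.

Lemma unif_disc (R : realType) (r : R) : 0 < r -> unif r (disc (0, 0) r) = 1.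
Proof. by move=> r0; rewrite /unif setIid divff// gt_eqF// fine_area_disc_gt0.
  Qed.

Lemma unif_rim_le (R : realType) (r s : R) : 0 < r -> 0 <= s ->
  unif r (rim r s) <= 40 * 100 * (s / r).
Proof.
move=> r0 s0; rewrite /unif ler_pdivrMr ?fine_area_disc_gt0//.
have /andP[h _] := fine_area_disc r0.
have : fine (area (rim r s `&` disc (0, 0) r)) <= 40 * r * s.
  rewrite -lee_fin fineK; first exact: area_rim_le.
  by apply: area_sub_fin => //; exact: measurable_rim.
move=> /le_trans; apply.
have -> : 40 * r * s = 40 * 100 * (s / r) * (r ^+ 2 / 100) by field;
  rewrite gt_eqF.
apply: ler_wpM2l; last exact: h.
by apply: mulr_ge0; [rewrite mulr_ge0|exact: divr_ge0 s0 (ltW r0)].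
Qed.

Lemma strip_sub_disc (R : realType) (r a b sg h1 h2 : R) : 0 < r -> 0 <= h1 ->
    h1 <= r ->
  strip r a b sg h1 h2 `<=` disc (0, 0) r.
Proof.
move=> r0 h0 hr p /stripP[_ H _ _ _]; rewrite (disc0E (ltW r0)) /=.
by apply: le_trans H _; nra.
Qed.

Lemma unif_strip_ge (R : realType) (r a b sg h1 h2 : R) : 0 < r ->
  sg = 1 \/ sg = - 1 -> a <= b -> 0 <= h1 -> h1 <= h2 -> h2 <= r ->
  h2 - r <= a -> b <= r - h2 ->
  (b - a) * (h2 - h1) / (4 * r ^+ 2) <= unif r (strip r a b sg h1 h2).
Proof.
move=> r0 sgE ab h0 h12 h2r ha hb.
have a0 := fine_area_disc_gt0 r0; have /andP[_ h] := fine_area_disc r0.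
rewrite /unif (setIidl (@strip_sub_disc R r a b sg h1 h2 r0 h0
  (le_trans h12 h2r))).
have ab0 : 0 <= (b - a) * (h2 - h1) by rewrite mulr_ge0// subr_ge0.
apply: ler_pM.
- exact: ab0.
- by rewrite invr_ge0; apply: mulr_ge0; [exact: ler0n|exact: sqr_ge0].
- rewrite -lee_fin fineK; first exact: area_strip_ge.
  rewrite -(setIidl (@strip_sub_disc R r a b sg h1 h2 r0 h0
    (le_trans h12 h2r))).
  by apply: area_sub_fin => //; exact: measurable_strip.
- rewrite lef_pV2; first exact: h.
    by rewrite posrE; apply: mulr_gt0; [exact: ltr0n|exact: exprn_gt0].
  by rewrite posrE.
Qed.

Lemma sample_prob d (T : measurableType d) (R : realType) (P : probability T R)
    (r : R) (n : nat) (X : 'I_n -> {RV P >-> plane R}) i B : 0 < r ->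
  uniform_sample (disc (0, 0) r) X -> measurable B ->
  P (X i @^-1` B) = (unif r B)%:E.
Proof.
move=> r0 [_ /(_ i B)] H mB; move: (H mB).
rewrite /distribution /pushforward => ->.
rewrite -(fineK (area_sub_fin r0 mB)) -(fineK (area_disc_fin r0)).
by rewrite inver gt_eqF ?fine_area_disc_gt0.
Qed.

Lemma sample_prod d (T : measurableType d) (R : realType) (P : probability T R)
    (r : R) (n : nat) (X : 'I_n -> {RV P >-> plane R}) (B : 'I_n ->
      set (plane R)) : 0 < r ->
  uniform_sample (disc (0, 0) r) X -> (forall i, measurable (B i)) ->
  P (\bigcap_(i in [set: 'I_n]) (X i @^-1` B i)) = (\prod_i unif r (B i))%:E.
Proof.
move=> r0 UX mB; have [H _] := UX; rewrite H// -prodEFin.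
by apply: eq_bigr => i _; apply: sample_prob.
Qed.

Lemma measurable_sample d (T : measurableType d) (R : realType)
    (P : probability T R)
    (n : nat) (X : 'I_n -> {RV P >-> plane R}) (B : 'I_n -> set (plane R)) :
  (forall i, measurable (B i)) ->
  measurable (\bigcap_(i in [set: 'I_n]) (X i @^-1` B i)).
Proof.
move=> mB; apply: fin_bigcap_measurable => //.
by move=> i _; rewrite -[X in measurable X]setTI; apply: measurable_funPT.
Qed.

Lemma measurable_tri (R : realType) (r h : R) j : measurable (tri_strip r h j).
Proof. by rewrite /tri_strip; do 2?[case: ifP => _];
  exact: measurable_strip. Qed.

Lemma measurable_quad (R : realType) (r h : R) j : measurable
    (quad_strip r h j).
Proof. by rewrite /quad_strip; case: ifP => _; exact: measurable_strip. Qed.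

(** The constant in the bound on the measure of a rim: 40 for the area, divided
    by the lower bound r^2 / 100 on the area of the disc, and 2 because widths
    are measured in units of 2r. It is kept as a product of small literals, as a
    large literal is a sum of ones. *)
Definition rim_rate (R : realType) : R := 40 * 100 * 2.

Lemma rim_rate_ge0 (R : realType) : 0 <= rim_rate R.
Proof. by rewrite !mulr_ge0. Qed.

Lemma rim_rate_ge1 (R : realType) : 1 <= rim_rate R.
Proof. by rewrite /rim_rate; lra. Qed.

Lemma unif_rim_step (R : realType) (r t : R) : 0 < r -> 0 <= t ->
  unif r (rim r (2 * r * t)) <= rim_rate R * t.
Proof.
move=> r0 t0; apply: le_trans.
  by apply: unif_rim_le => //; rewrite !mulr_ge0// ltW.
have -> : 2 * r * t / r = 2 * t by field; rewrite gt_eqF.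
by rewrite /rim_rate !mulrA.
Qed.

Lemma unif_tri_ge (R : realType) (r t : R) j : 0 < r -> 0 <= t -> t <= 1 ->
  t / 400 <= unif r (tri_strip r (r / 10 * t) j).
Proof.
move=> r0 t0 t1.
have h0 : 0 <= r / 10 * t by rewrite mulr_ge0// divr_ge0// ltW.
have hr : r / 10 * t <= r / 10 by rewrite ler_piMr// divr_ge0// ltW.
have -> : t / 400 = (8 / 10 * r - 7 / 10 * r) * (r / 10 * t - 0) / (4 * r ^+ 2).
  by field; rewrite gt_eqF.
rewrite /tri_strip; case: ifP => _; [|case: ifP => _].
- apply: le_trans; last by apply: unif_strip_ge => //; [left|lra..].
  apply: ler_wpM2r; first by rewrite invr_ge0 mulr_ge0// sqr_ge0.
  by apply: ler_wpM2r; lra.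
- by apply: unif_strip_ge => //; [right|lra..].
- have -> : 8 / 10 * r - 7 / 10 * r = - (7 / 10 * r) - - (8 / 10 * r) by ring.
  by apply: unif_strip_ge => //; [right|lra..].
Qed.

(** The computation gives t / 8000; this happens to be the same constant as for
    the rim. *)
Lemma unif_quad_ge (R : realType) (r t : R) j : 0 < r -> 0 <= t -> t <= 1 ->
  t / rim_rate R <= unif r (quad_strip r (r / 10 * t) j).
Proof.
move=> r0 t0 t1.
have h0 : 0 <= r / 10 * t by rewrite mulr_ge0// divr_ge0// ltW.
have hr : r / 10 * t <= r / 10 by rewrite ler_piMr// divr_ge0// ltW.
have -> : t / rim_rate R = (71 / 100 * r - 70 / 100 * r) *
  (r / 10 * t - r / 10 * t / 2) / (4 * r ^+ 2).
  by rewrite /rim_rate; field; rewrite gt_eqF.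
have sg : quad_sy R j = 1 \/ quad_sy R j = -1.
  by rewrite /quad_sy; case: odd; [right|left].
rewrite /quad_strip; case: ifP => _.
- by apply: unif_strip_ge => //; lra.
- have -> : 71 / 100 * r - 70 / 100 * r = - (70 / 100 * r) - -
  (71 / 100 * r) by ring.
  by apply: unif_strip_ge => //; lra.
Qed.

(** * Finite sums and powers *)

(** The sum telescopes: (k+1)^2 q^k = F k - F (k+1) for F k = q^k (a (k+1)^2 + b
    (k+1) + g), with a, b, g determined by q. *)
Lemma sum_sqr_geo_le (R : realType) (q : R) : 0 <= q -> q < 1 ->
  exists2 B : R, 0 <= B & forall N : nat, \sum_(k < N) k.+1%:R ^+ 2 * q ^+ k <=
    B.
Proof.
move=> q0 q1.
pose a : R := (1 - q)^-1; pose b := 2 * q * a * a; pose g := q * (a + b) * a.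
have a0 : 0 < a by rewrite invr_gt0 subr_gt0.
have aE : a * (1 - q) = 1 by rewrite mulVf// subr_eq0 gt_eqF.
have b0 : 0 <= b by rewrite !mulr_ge0// ltW.
have g0 : 0 <= g by rewrite !mulr_ge0// ?addr_ge0// ltW.
pose F (k : nat) : R := q ^+ k * (a * k.+1%:R ^+ 2 + b * k.+1%:R + g).
have F0 k : 0 <= F k.
  by rewrite mulr_ge0 ?exprn_ge0// !addr_ge0// mulr_ge0 ?exprn_ge0// ltW.
have FS k : k.+1%:R ^+ 2 * q ^+ k = F k - F k.+1.
  rewrite /F (exprS q) -[in k.+2%:R]addn1 natrD; set t : R := k.+1%:R;
    set u := q ^+ k.
  have bE : b * (1 - q) = 2 * q * a by rewrite /b -mulrA aE mulr1.
  have gE : g * (1 - q) = q * (a + b) by rewrite /g -mulrA aE mulr1.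
  have -> : u * (a * t ^+ 2 + b * t + g) - q * u *
    (a * (t + 1) ^+ 2 + b * (t + 1) + g) =
    u * ((a * (1 - q)) * t ^+ 2 + (b * (1 - q)) * t - 2 * q * a * t + g *
      (1 - q)
      - q * (a + b)) by ring.
  by rewrite aE bE gE; ring.
exists (F 0) => // N.
suff : \sum_(k < N) k.+1%:R ^+ 2 * q ^+ k = F 0 - F N.
  by move=> ->; rewrite gerBl.
elim: N => [|N IH]; first by rewrite big_ord0 subrr.
by rewrite big_ord_recr/= IH FS; ring.
Qed.

Lemma prod_two_values (R : comPzRingType) (n : nat) (Q : pred 'I_n) (a b : R) :
  \prod_(l < n) (if Q l then a else b) = a ^+ #|Q| * b ^+ (n - #|Q|).
Proof.
rewrite (bigID Q)/=; congr (_ * _).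
  by rewrite (eq_bigr (fun=> a)) ?prodr_const// => i ->.
rewrite (eq_bigr (fun=> b)); last by move=> i /negbTE ->.
rewrite prodr_const; congr (_ ^+ _).
by rewrite -[X in (X - _)%N]card_ord -(cardC Q) addKn.
Qed.

(** Applied with m among n - 2, n - 1 and n, as m / n >= 1/3. *)
Lemma one_sub_pow_le (R : realType) (u c : R) (n m : nat) : (3 <= n)%N ->
    (n <= m + 2)%N ->
  u <= 1 -> c / n%:R <= u -> 0 <= c -> (1 - u) ^+ m <= expR (- (c / 3)).
Proof.
move=> n3 nm u1 cu c0.
have n0 : 0 < n%:R :> R by rewrite ltr0n; lia.
have u0 : 0 <= u by apply: le_trans cu; rewrite divr_ge0// ltW.
apply: (@le_trans _ _ (expR (- u) ^+ m)).
  by apply: lerXn2r; rewrite ?nnegrE ?expR_ge0 ?subr_ge0 ?expR_ge1Dx.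
rewrite -expRM_natl ler_expR mulrN lerN2.
have m3 : n%:R <= 3 * m%:R :> R by rewrite -natrM ler_nat; lia.
apply: (@le_trans _ _ (m%:R * (c / n%:R))); last by rewrite ler_wpM2l.
rewrite mulrCA ler_wpM2l// ler_pdivlMr// mulrC ler_pdivrMr// mulrC; exact: m3.
Qed.

Lemma ffact_ge (R : realType) (n m : nat) : (m * 2 <= n)%N ->
  (n%:R / 2) ^+ m <= (n ^_ m)%:R :> R.
Proof.
move=> mn; rewrite ffact_prod natr_prod -[X in _ ^+ X]card_ord -prodr_const.
apply: ler_prod => i _; rewrite divr_ge0//= ler_pdivrMr// -natrM ler_nat.
by have := ltn_ord i; lia.
Qed.

Lemma one_sub_div_pow_ge (R : realType) (C : R) (n m : nat) : (0 < n)%N ->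
    (m <= n)%N -> 0 <= C ->
  2 * C <= n%:R -> expR (- (2 * C)) <= (1 - C / n%:R) ^+ m.
Proof.
move=> n0 mn C0 Cn.
have n0' : 0 < n%:R :> R by rewrite ltr0n.
set x := C / n%:R.
have x0 : 0 <= x by rewrite divr_ge0// ltW.
have x1 : x <= 1 / 2 by rewrite /x ler_pdivrMr//; lra.
apply: (@le_trans _ _ (expR (- (2 * x)) ^+ m)).
  rewrite -expRM_natl ler_expR mulrN lerN2.
  have -> : 2 * C = n%:R * (2 * x) by rewrite /x; field; rewrite gt_eqF.
  by rewrite ler_wpM2r ?mulr_ge0// ler_nat.
apply: lerXn2r; rewrite ?nnegrE ?expR_ge0//; first by lra.
rewrite expRN invf_ple ?posrE ?expR_gt0//; last by lra.
apply: (@le_trans _ _ (1 + 2 * x)); last exact: expR_ge1Dx.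
by rewrite invf_ple ?posrE; [|lra|lra];
  rewrite -(ler_pM2r (_ : 0 < 1 + 2 * x)) ?mulVf; nra.
Qed.

Lemma ler_sum_term (R : realType) (I : finType) (F : I -> R) i :
  (forall j, 0 <= F j) -> F i <= \sum_j F j.
Proof. by move=> F0; rewrite (bigD1 i)//= lerDl sumr_ge0. Qed.

Lemma sqr_card (R : realType) (n : nat) (B : pred 'I_n) :
  (#|B|%:R : R) ^+ 2 = \sum_i \sum_i' (B i)%:R * (B i')%:R.
Proof.
have -> : #|B|%:R = \sum_i (B i)%:R :> R.
  by rewrite -sum1_card natr_sum big_mkcond; apply: eq_bigr => i _;
    rewrite unfold_in; case: (B i).
rewrite expr2 mulr_suml; apply: eq_bigr => i _.
by rewrite mulr_sumr.
Qed.

Lemma big_quadruple (R : realType) (I J K L : finType) (G : I * (J * (K * L)) ->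
    R) :
  \sum_s G s = \sum_i \sum_j \sum_k \sum_l G (i, (j, (k, l))).
Proof.
rewrite [RHS](eq_bigr (fun i => \sum_j \sum_kl G (i, (j, kl)))); last first.
  move=> i _; apply: eq_bigr => j _; rewrite pair_bigA /=.
  by apply: eq_bigr => -[].
rewrite [RHS](eq_bigr (fun i => \sum_jkl G (i, jkl))); last first.
  by move=> i _; rewrite pair_bigA /=; apply: eq_bigr => -[].
by rewrite [RHS]pair_bigA /=; apply: eq_bigr => -[].
Qed.

Lemma sqr_sub_le (R : realType) (x m M : R) : 0 <= x -> 0 <= m -> m <= M ->
  (x - m) ^+ 2 <= M ^+ 2 + x ^+ 2.
Proof. by nra. Qed.

Lemma sqr_sub_le2 (R : realType) (x a m y z : R) : x <= a -> a - x <= z ->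
  m <= a -> a - y <= m -> (x - m) ^+ 2 <= 2 * y ^+ 2 + 2 * z ^+ 2.
Proof. by nra. Qed.

Lemma sqr_dist_ge_below (R : realType) (z mu : R) : 7 / 2 <= mu -> z <= 3 ->
  1 / 4 <= (z - mu) ^+ 2.
Proof. by nra. Qed.

Lemma sqr_dist_ge_above (R : realType) (z mu : R) : mu < 7 / 2 -> 4 <= z ->
  1 / 4 <= (z - mu) ^+ 2.
Proof. by nra. Qed.

(** * How far the polygon stays from the circle *)

(** Take the largest k <= n such that one of the strips of depth (r/10)(k/n) is
    missed; k = 0 qualifies, as strips of depth 0 are empty. If k < n then all
    strips of the next depth are hit, and if k = n the bound 2r is the trivial
    one. *)
Lemma rdual_cover (R : realType) (r : R) (n : nat) (x : 'I_n -> plane R) :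
  0 < r -> (0 < n)%N -> range x `<=` disc (0, 0) r ->
  exists (k : 'I_n.+1) (j : 'I_3),
    (forall l, ~ tri_strip r (r / 10 * (k%:R / n%:R)) j (x l)) /\
    rdual r (range x) `<=` disc (0, 0) (2 * r * (k.+1%:R / n%:R)).
Proof.
move=> r0 n0 xK.
have n0' : 0 < n%:R :> R by rewrite ltr0n.
pose E (k : nat) := exists j, forall l, ~ tri_strip r (r / 10 * (k%:R / n%:R)) j
  (x l).
have E0 : E 0%N.
  exists ord0 => l /stripP[+ H _ _ _]; rewrite mul0r mulr0 subr0 => H'.
  by move: H; rewrite subr0 leNgt H'.
have ex : exists k, (k <= n)%N && `[< E k >] by exists 0%N; apply/asboolP.
have bd k : (k <= n)%N && `[< E k >] -> (k <= n)%N by case/andP.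
case: (ex_maxnP ex bd) => k /andP[kn /asboolP[j Ej]] kmax.
exists (Ordinal (kn : (k < n.+1)%N)), j; split => //=.
have [kn'|kn'] := leqP n k.
  have pol := @rdual_sub_disc2 R r (range x) xK
    (ex_intro _ (x (Ordinal n0)) (ex_intro2 _ _ (Ordinal n0) I erefl)).
  move=> c /pol; rewrite /disc /= => /le_trans; apply.
  by rewrite ler_peMr ?mulr_ge0 ?(ltW r0)// ler_pdivlMr// mul1r ler_nat ltnW.
have -> : 2 * r * (k.+1%:R / n%:R) = 20 * (r / 10 * (k.+1%:R / n%:R)) by field;
  rewrite gt_eqF.
apply: rdual_tri => //.
- by rewrite mulr_ge0 ?divr_ge0 ?(ltW r0).
- rewrite ler_piMr ?divr_ge0 ?(ltW r0)// ler_pdivrMr// mul1r ler_nat//.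
move=> i; apply: contrapT => H.
have : (k.+1 <= k)%N; last by rewrite ltnn.
apply: kmax; rewrite kn'; apply/asboolP; exists i => l xl.
by apply: H; exists (x l); split => //; exists l.
Qed.

(** A strip of depth (r/10)(k/n) has measure at least k/(400 n), and at least
    n/3 points are available to miss it. *)
Definition miss_rate (R : realType) : R := expR (- (1 / 400 / 3)).

Lemma miss_rate_itv (R : realType) : 0 <= miss_rate R < 1.
Proof.
by apply/andP; split; rewrite /miss_rate;
  [exact: expR_ge0|rewrite expR_lt1; lra].
Qed.

Lemma tri_miss_pow (R : realType) (r : R) (n m : nat) (k : 'I_n.+1) j :
  0 < r -> (3 <= n)%N -> (n <= m + 2)%N ->
  unif r (~` tri_strip r (r / 10 * (k%:R / n%:R)) j) ^+ m <= miss_rate R ^+ k.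
Proof.
move=> r0 n3 nm; have n0 : 0 < n%:R :> R by rewrite ltr0n; lia.
rewrite unifC//; last exact: measurable_tri.
have kn1 : k%:R / n%:R <= 1 :> R by rewrite ler_pdivrMr// mul1r ler_nat -ltnS.
have kn0 : 0 <= k%:R / n%:R :> R by rewrite divr_ge0// ltW.
have := @one_sub_pow_le R (unif r (tri_strip r (r / 10 * (k%:R / n%:R)) j))
  (k%:R / 400) n m n3 nm.
have -> : expR (- (k%:R / 400 / 3)) = miss_rate R ^+ k.
  by rewrite /miss_rate -expRM_natl; congr expR; field.
apply.
- by apply: unif_le1 => //; exact: measurable_tri.
- by rewrite mulrAC; exact: unif_tri_ge.
- by apply: divr_ge0; exact: ler0n.
Qed.

(** Requiring these memberships for all l says that x_i and x_i' are in the rim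
    and that the strip is missed by all the other points. *)
Definition two_in_rim (R : realType) (r : R) (n : nat) (k : 'I_n.+1) (j : 'I_3)
    (i i' l : 'I_n)
    : set (plane R) :=
  if pred2 i i' l then rim r (2 * r * (k.+1%:R / n%:R))
  else ~` tri_strip r (r / 10 * (k%:R / n%:R)) j.

Lemma measurable_two_in_rim (R : realType) (r : R) (n : nat) (k : 'I_n.+1) j
    (i i' l : 'I_n) :
  measurable (two_in_rim r k j i i' l).
Proof.
rewrite /two_in_rim; case: ifP => _; first exact: measurable_rim.
by apply: measurableC; exact: measurable_tri.
Qed.

(** There is a factor O(k/n) for each of the one or two indices among i and i',
    and the other points, at least n - 2 of them, miss the strip. *)
Lemma two_in_rim_prob d (T : measurableType d) (R : realType)
    (P : probability T R)
    (r : R) (n : nat) (X : 'I_n -> {RV P >-> plane R}) (k : 'I_n.+1) j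
      (i i' : 'I_n) :
  0 < r -> (3 <= n)%N -> uniform_sample (disc (0, 0) r) X ->
  (P (\bigcap_(l in [set: 'I_n]) (X l @^-1` two_in_rim r k j i i' l)) <=
   ((rim_rate R * (k.+1%:R / n%:R)) ^+ (i != i').+1 * miss_rate R ^+ k)%:E)%E.
Proof.
move=> r0 n3 UX; rewrite (sample_prod r0 UX); last by move=> l;
  exact: measurable_two_in_rim.
rewrite lee_fin.
set a := unif r (rim r (2 * r * (k.+1%:R / n%:R))).
set b := unif r (~` tri_strip r (r / 10 * (k%:R / n%:R)) j).
have -> : \prod_l unif r (two_in_rim r k j i i' l) = \prod_(l < n)
  (if pred2 i i' l then a else b).
  by apply: eq_bigr => l _; rewrite /two_in_rim; case: ifP.
rewrite prod_two_values card2.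
apply: ler_pM.
- by apply: exprn_ge0; exact: unif_ge0.
- by apply: exprn_ge0; exact: unif_ge0.
- have t0 : 0 <= k.+1%:R / n%:R :> R by apply: divr_ge0; exact: ler0n.
  apply: lerXn2r; last exact: unif_rim_step.
    by rewrite nnegrE; exact: unif_ge0.
  by rewrite nnegrE; apply: mulr_ge0; [exact: rim_rate_ge0|exact: t0].
- by apply: tri_miss_pow => //; case: (i != i') => /=; lia.
Qed.

Lemma tri_miss_prob d (T : measurableType d) (R : realType)
    (P : probability T R)
    (r : R) (n : nat) (X : 'I_n -> {RV P >-> plane R}) (k : 'I_n.+1) j :
  0 < r -> (3 <= n)%N -> uniform_sample (disc (0, 0) r) X ->
  (P (\bigcap_(l in [set: 'I_n])
    (X l @^-1` (~` tri_strip r (r / 10 * (k%:R / n%:R)) j))) <=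
   (miss_rate R ^+ k)%:E)%E.
Proof.
move=> r0 n3 UX; rewrite (sample_prod r0 UX); last first.
  by move=> l; apply: measurableC; exact: measurable_tri.
rewrite lee_fin prodr_const card_ord; apply: tri_miss_pow => //; lia.
Qed.

(** * The upper bound on the variance of the number of vertices *)

(** The points are in the disc only almost surely. *)
Definition escape d (T : measurableType d) (R : realType) (P : probability T R)
    (r : R) (n : nat) (X : 'I_n -> {RV P >-> plane R}) : set T :=
  ~` \bigcap_(i in [set: 'I_n]) (X i @^-1` (disc (0, 0) r)).

Lemma escapeP d (T : measurableType d) (R : realType) (P : probability T R)
    (r : R) (n : nat) (X : 'I_n -> {RV P >-> plane R}) : 0 < r ->
  uniform_sample (disc (0, 0) r) X ->
  measurable (escape r X) /\ P (escape r X) = 0%E.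
Proof.
move=> r0 UX; have mK := measurable_disc0 (ltW r0).
have mI : measurable (\bigcap_(i in [set: 'I_n]) (X i @^-1` (disc (0, 0) r))).
  by apply: measurable_sample.
split; first exact: measurableC.
rewrite probability_setC// (sample_prod (B := fun=> _) r0 UX)// big1 ?subee//.
by move=> i _; apply: unif_disc.
Qed.

Lemma in_disc_of_escape d (T : measurableType d) (R : realType)
    (P : probability T R)
    (r : R) (n : nat) (X : 'I_n -> {RV P >-> plane R}) w : ~ escape r X w ->
  range (fun i => X i w) `<=` disc (0, 0) r.
Proof. by move=> /contrapT H _ [i _ <-]; exact: H. Qed.

(** For the k and the strip given by [rdual_cover], the vertices are sample
    points in the rim of width 2r (k+1)/n, and the square of the number of such
    points counts pairs (i, i'). *)
Lemma f0_sqr_le d (T : measurableType d) (R : realType) (P : probability T R)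
    (r : R) (n : nat) (X : 'I_n -> {RV P >-> plane R}) w : 0 < r -> (0 < n)%N ->
  ~ escape r X w ->
  (f0 r (random_disc_polygon r X w))%:R ^+ 2 <=
  \sum_(s : 'I_n.+1 * ('I_3 * ('I_n * 'I_n)))
    1 * \1_(\bigcap_(l in [set: 'I_n])
      (X l @^-1` two_in_rim r s.1 s.2.1 s.2.2.1 s.2.2.2 l)) w :> R.
Proof.
move=> r0 n0 wN; have xK := in_disc_of_escape wN.
have [k [j [jmiss pol]]] := rdual_cover r0 n0 xK.
pose A := rim r (2 * r * (k.+1%:R / n%:R)).
pose B : pred 'I_n := [pred i | `[< A (X i w) >]].
have fB : (f0 r (random_disc_polygon r X w) <= #|B|)%N.
  by apply: (@f0_le R r n (fun i => X i w) B) => // i /(vertex_in_rim pol) H;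
    apply/asboolP.
apply: (@le_trans _ _ (#|B|%:R ^+ 2)).
  by apply: lerXn2r; rewrite ?nnegrE ?ler0n// ler_nat.
pose G (s : 'I_n.+1 * ('I_3 * ('I_n * 'I_n))) : R :=
  1 * \1_(\bigcap_(l in [set: 'I_n])
    (X l @^-1` two_in_rim r s.1 s.2.1 s.2.2.1 s.2.2.2 l)) w.
have G0 s : 0 <= G s by rewrite /G mul1r indicE ler0n.
rewrite (big_quadruple G).
apply: le_trans (ler_sum_term k _); last first.
  by move=> k'; do 3![apply: sumr_ge0 => ? _]; exact: G0.
apply: le_trans (ler_sum_term j _); last first.
  by move=> j'; do 2![apply: sumr_ge0 => ? _]; exact: G0.
rewrite sqr_card; apply: ler_sum => i _; apply: ler_sum => i' _.
have [Bi|Bi] := boolP (B i); last by rewrite mul0r; exact: G0.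
have [Bi'|Bi'] := boolP (B i'); last by rewrite mulr0; exact: G0.
rewrite mulr1 /G mul1r indicE mem_set// => l _ /=; rewrite /two_in_rim.
case: ifPn => [/orP[/eqP->|/eqP->]|_];
  [exact/asboolP/Bi|exact/asboolP/Bi'|exact: jmiss].
Qed.

(** For a given k, the n diagonal pairs contribute O(k) and the n^2 other pairs
    O(k^2). *)
Lemma two_in_rim_sum_le (R : realType) (B : R) : 
  (forall N : nat, \sum_(k < N) k.+1%:R ^+ 2 * miss_rate R ^+ k <= B) ->
  forall n, (0 < n)%N ->
  \sum_(s : 'I_n.+1 * ('I_3 * ('I_n * 'I_n)))
    1 * ((rim_rate R * (s.1.+1%:R / n%:R)) ^+
      (s.2.2.1 != s.2.2.2).+1 * miss_rate R ^+ s.1)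
  <= 3 * (rim_rate R + rim_rate R ^+ 2) * B.
Proof.
move=> HB n n0.
have n0' : 0 < n%:R :> R by rewrite ltr0n.
have /andP[q0 _] := miss_rate_itv R.
move: (rim_rate R) (rim_rate_ge0 R) => D D0.
pose G (s : 'I_n.+1 * ('I_3 * ('I_n * 'I_n))) : R :=
  1 * ((D * (s.1.+1%:R / n%:R)) ^+ (s.2.2.1 != s.2.2.2).+1 * miss_rate R ^+
    s.1).
rewrite (big_quadruple G) /G /=.
apply: (@le_trans _ _ (\sum_(k < n.+1) 3 * (D + D ^+ 2) *
  (k.+1%:R ^+ 2 * miss_rate R ^+ k))); last first.
  rewrite -mulr_sumr ler_wpM2l// mulr_ge0 ?ler0n// addr_ge0// exprn_ge0//.
apply: ler_sum => k _.
rewrite sumr_const card_ord -[leLHS]mulr_natl -[leRHS]mulrA ler_wpM2l ?ler0n//.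
have qk : 0 <= miss_rate R ^+ k by rewrite exprn_ge0.
set t := k.+1%:R / n%:R.
have t0 : 0 <= t by rewrite divr_ge0// ltW.
have tE : n%:R * t = k.+1%:R by rewrite /t mulrC divfK// gt_eqF.
apply: (@le_trans _ _ (\sum_(i < n) \sum_(i' < n)
   ((i == i')%:R * (D * t) + (D * t) ^+ 2) * miss_rate R ^+ k)).
  apply: ler_sum => i _; apply: ler_sum => i' _; rewrite mul1r.
  rewrite ler_wpM2r//; case: eqVneq => _ /=;
    first by rewrite mul1r expr1 lerDl sqr_ge0.
  by rewrite mul0r add0r.
rewrite (eq_bigr (fun _ : 'I_n =>
  (D * t + n%:R * (D * t) ^+ 2) * miss_rate R ^+ k)); last first.
  move=> i _; rewrite -mulr_suml big_split /= -mulr_suml.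
  rewrite (bigD1 i)//= eqxx big1; last by move=> i' /negbTE;
    rewrite eq_sym => ->.
  by rewrite addr0 mul1r sumr_const card_ord -[_ *+ n]mulr_natl.
rewrite sumr_const card_ord -[leLHS]mulr_natl.
have -> : n%:R * ((D * t + n%:R * (D * t) ^+ 2) * miss_rate R ^+ k) =
  (D * (n%:R * t) + D ^+ 2 * (n%:R * t) ^+ 2) * miss_rate R ^+ k by ring.
rewrite tE mulrA ler_wpM2r// mulrDl lerD2r ler_wpM2l// -natrX ler_nat.
by rewrite expnS expn1 leq_pmulr.
Qed.

(** For an integer f0 <= f0^2, so that the bound M on the second moment also
    bounds the mean m, and (f0 - m)^2 <= f0^2 + M^2 as both are nonnegative. *)
Lemma f0_var_le d (T : measurableType d) (R : realType) (P : probability T R)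
    (r : R) (n : nat) (X : 'I_n -> {RV P >-> plane R}) (B M : R) : 0 < r ->
      (3 <= n)%N ->
  (forall N : nat, \sum_(k < N) k.+1%:R ^+ 2 * miss_rate R ^+ k <= B) ->
  M = 3 * (rim_rate R + rim_rate R ^+ 2) * B ->
  uniform_sample (disc (0, 0) r) X ->
  ('V_P[fun w => (f0 r (random_disc_polygon r X w))%:R] <= (M ^+ 2 + M)%:E)%E.
Proof.
move=> r0 n3 HB ME UX; have n0 : (0 < n)%N by exact: leq_trans n3.
have [mN PN] := escapeP r0 UX.
set f : T -> R := fun w => _.
have f0 w : 0 <= f w by exact: ler0n.
pose F (s : 'I_n.+1 * ('I_3 * ('I_n * 'I_n))) :=
  \bigcap_(l in [set: 'I_n])
    (X l @^-1` two_in_rim r s.1 s.2.1 s.2.2.1 s.2.2.2 l).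
have mF s : measurable (F s).
  by apply: measurable_sample => l; exact: measurable_two_in_rim.
have PF s := two_in_rim_prob s.1 s.2.1 s.2.2.1 s.2.2.2 r0 n3 UX.
have fle w : ~ escape r X w -> f w ^+ 2 <= \sum_s 1 * \1_(F s) w.
  by move=> wN; exact: f0_sqr_le.
have SM := two_in_rim_sum_le HB n0; rewrite -ME in SM.
have a0 (s : 'I_n.+1 * ('I_3 * ('I_n * 'I_n))) : 0 <= 1 :> R by exact: ler01.
have mM : fine ('E_P[f])%E <= M.
  apply: mean_le => //; rewrite mean_integral.
  apply: le_trans; first apply: (integral_le_sum_indic a0 mF PF mN PN f0) =>
    w /fle.
    apply: le_trans; rewrite /f -natrX ler_nat.
    by case: (Defs.f0 _ _) => // k; rewrite expnS expn1 leq_pmulr.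
  by rewrite lee_fin.
have m0 : 0 <= fine ('E_P[f])%E by exact: mean_ge0.
rewrite variance_integral; set m := fine _ in mM m0 *.
apply: le_trans; first apply:
  (integral_le_cst_sum_indic (c := M ^+ 2) a0 mF PF mN PN).
- exact: sqr_ge0.
- by move=> w; exact: sqr_ge0.
- move=> w /fle H; apply: (@le_trans _ _ (M ^+ 2 + f w ^+ 2));
  last by rewrite lerD2l.
  exact: sqr_sub_le.
by rewrite lee_fin lerD2l.
Qed.

(** * The upper bound on the variance of the area *)

(** The hull is convex, so that its sections are intervals. *)
Lemma xsection_rhull_measurable (R : realType) (r : R) (X : set (plane R))
    (x : measurableTypeR R) : 0 <= r ->
  measurable (xsection (rhull r X) x).
Proof.
move=> r0; apply: is_interval_measurable => y1 y2 /=.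
rewrite /xsection /= !inE => H1 H2 y /andP[y1y yy2]; rewrite inE => c Xc.
move: (H1 c Xc) (H2 c Xc); rewrite /disc /= !dist2_le//=.
have [yc|yc] := leP y c.2 => h1 h2.
  by apply: le_trans _ h1; rewrite lerD2l; nra.
by apply: le_trans _ h2; rewrite lerD2l; nra.
Qed.

Lemma area_le_of_xsection (R : realType) (A B : set (plane R)) :
  (forall x : measurableTypeR R, measurable (xsection A x)) ->
  (forall x : measurableTypeR R, measurable (xsection B x)) -> A `<=` B ->
  (area A <= area B)%E.
Proof.
move=> mA mB AB; apply: ge0_le_integral_nomeas => x /=;
  first exact: measure_ge0.
apply: le_measure; rewrite ?inE//.
by move=> y; rewrite /xsection /= !inE => /AB.
Qed.

(** The hull is compared section by section with the disc and with the
    complement of the rim in the disc, whose areas add up. *)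
Lemma area_rhull (R : realType) (r s : R) (X : set (plane R)) : 0 < r ->
    0 <= s ->
  X `<=` disc (0, 0) r -> rdual r X `<=` disc (0, 0) s ->
  fine (area (disc (0, 0) r)) - 40 * r * s <= fine (area (rhull r X)) <=
  fine (area (disc (0, 0) r)).
Proof.
move=> r0 s0 XK pol; have mK := measurable_disc0 (ltW r0);
  set K := disc (0, 0) r.
have mh (x : measurableTypeR R) := xsection_rhull_measurable X x (ltW r0).
have mA := measurable_rim r s.
have mAC : measurable (~` rim r s `&` K) by apply: measurableI => //;
  exact: measurableC.
have hK : (area (rhull r X) <= area K)%E.
  apply: area_le_of_xsection => //; first by move=> x;
    exact: measurable_xsection.
  exact: rhull_sub_disc.
have hA : (area (~` rim r s `&` K) <= area (rhull r X))%E.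
  apply: area_le_of_xsection => //; first by move=> x;
    exact: measurable_xsection.
  by move=> p [+ _]; exact: (disc_sub_rhull pol).
have fK := area_disc_fin r0.
have fA := area_sub_fin r0 mA; have fAC := area_sub_fin r0 (measurableC mA).
have fh : area (rhull r X) \is a fin_num.
  rewrite ge0_fin_numE; first by apply: le_lt_trans hK _;
    rewrite -ge0_fin_numE// measure_ge0.
  exact: measure_ge0.
rewrite -(fineK fK) -(fineK fh) lee_fin in hK.
rewrite -(fineK fAC) -(fineK fh) lee_fin in hA.
rewrite hK andbT.
have hann := area_rim_le r0 s0; rewrite -(fineK fA) lee_fin in hann.
rewrite (fine_area_split r0 mA) lerBlDr addrC.
exact: lerD.
Qed.

(** The missing area a - f is at most D (k+1)/n on the event attached to k. This
    bounds both a - m, where m is the mean, and the second moment of a - f, and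
    (f - m)^2 <= 2 (a - m)^2 + 2 (a - f)^2. *)
Lemma area_var_le d (T : measurableType d) (R : realType) (P : probability T R)
    (r : R) (n : nat) (X : 'I_n -> {RV P >-> plane R}) (B D : R) : 0 < r ->
      (3 <= n)%N ->
  (forall N : nat, \sum_(k < N) k.+1%:R ^+ 2 * miss_rate R ^+ k <= B) ->
  D = 80 * r ^+ 2 ->
  uniform_sample (disc (0, 0) r) X ->
  ('V_P[fun w => fine (area (random_disc_polygon r X w))] <=
     ((2 * (3 * D * B) ^+ 2 + 6 * D ^+ 2 * B) * n%:R ^- 2)%:E)%E.
Proof.
move=> r0 n3 HB DE UX; have n0 : (0 < n)%N by exact: leq_trans n3.
have n0' : 0 < n%:R :> R by rewrite ltr0n.
have [mN PN] := escapeP r0 UX.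
have D0 : 0 <= D by rewrite DE mulr_ge0// sqr_ge0.
set f : T -> R := fun w => _.
have f0 w : 0 <= f w by rewrite fine_ge0//; exact: measure_ge0.
pose a := fine (area (disc (0, 0) r)).
have a0 : 0 <= a by rewrite ltW// fine_area_disc_gt0.
pose t (k : nat) : R := k.+1%:R / n%:R.
have t0 k : 0 <= t k by rewrite divr_ge0// ltW.
pose F (s : 'I_n.+1 * 'I_3) :=
  \bigcap_(l in [set: 'I_n])
    (X l @^-1` (~` tri_strip r (r / 10 * (s.1%:R / n%:R)) s.2)).
have mF s : measurable (F s).
  by apply: measurable_sample => l; apply: measurableC; exact: measurable_tri.
have PF s := tri_miss_prob s.1 s.2 r0 n3 UX.
have fcov w : ~ escape r X w -> f w <= a /\
    exists2 s, F s w & a - f w <= D * t s.1.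
  move=> wN; have xK := in_disc_of_escape wN.
  have [k [j [jmiss pol]]] := rdual_cover r0 n0 xK.
  have tk0 : 0 <= 2 * r * (k.+1%:R / n%:R) by apply: mulr_ge0;
    [rewrite mulr_ge0// ltW|exact: t0].
  have /andP[h1 h2] := area_rhull r0 tk0 xK pol.
  split; first exact: h2.
  exists (k, j); first by move=> l _ /=; exact: jmiss.
  rewrite DE /= -[40 * r * _]/(40 * r * (2 * r * t k)) in h1 *.
  have -> : 80 * r ^+ 2 * t k = 40 * r * (2 * r * t k) by ring.
  by rewrite lerBlDr -lerBlDl; exact: h1.
have cov_sum w (g : nat -> R) : (forall k, 0 <= g k) ->
    forall s, F s w -> g s.1 <= \sum_(s0 : 'I_n.+1 * 'I_3) g s0.1 * \1_(F s0) w.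
  move=> g0 s Fs.
  have H0 (s0 : 'I_n.+1 * 'I_3) : 0 <= g s0.1 * \1_(F s0) w by rewrite mulr_ge0.
  apply: le_trans (ler_sum_term s H0).
  by rewrite indicE mem_set// mulr1.
have g1 k : 0 <= D * t k by rewrite mulr_ge0.
have g2 k : 0 <= 2 * (D * t k) ^+ 2 by rewrite mulr_ge0// sqr_ge0.
have /andP[q0 _] := miss_rate_itv R.
have tsq k : t k ^+ 2 = k.+1%:R ^+ 2 * n%:R ^- 2 by rewrite /t expr_div_n.
have sum1 : \sum_(s : 'I_n.+1 * 'I_3) D * t s.1 * miss_rate R ^+ s.1 <=
  3 * D * B / n%:R.
  rewrite -(pair_bigA _ (fun (k : 'I_n.+1) (j : 'I_3) =>
    D * t k * miss_rate R ^+ k)) /=.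
  apply: (@le_trans _ _ (\sum_(k < n.+1) 3 * D / n%:R *
    (k.+1%:R ^+ 2 * miss_rate R ^+ k))).
    apply: ler_sum => k _; rewrite sumr_const card_ord -[leLHS]mulr_natl /t.
    have -> : 3 * (D * (k.+1%:R / n%:R) * miss_rate R ^+ k) =
      3 * D / n%:R * (k.+1%:R * miss_rate R ^+ k) by field; rewrite gt_eqF.
    apply: ler_wpM2l; first by rewrite divr_ge0 ?(ltW n0')// mulr_ge0.
    apply: ler_wpM2r; first exact: exprn_ge0.
    by rewrite -natrX ler_nat expnS expn1 leq_pmulr.
  rewrite -mulr_sumr mulrAC; apply: ler_wpM2r; first by rewrite invr_ge0 ltW.
  by apply: ler_wpM2l; [rewrite mulr_ge0|exact: HB].
have sum2 : \sum_(s : 'I_n.+1 * 'I_3) 2 *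
  (D * t s.1) ^+ 2 * miss_rate R ^+ s.1 <=
    6 * D ^+ 2 * B * n%:R ^- 2.
  rewrite -(pair_bigA _ (fun (k : 'I_n.+1) (j : 'I_3) =>
    2 * (D * t k) ^+ 2 * miss_rate R ^+ k)) /=.
  rewrite (eq_bigr (fun k : 'I_n.+1 => 6 * D ^+ 2 * n%:R ^- 2 *
    (k.+1%:R ^+ 2 * miss_rate R ^+ k))).
    rewrite -mulr_sumr mulrAC; apply: ler_wpM2r;
      first by rewrite invr_ge0 sqr_ge0.
    by apply: ler_wpM2l; [rewrite mulr_ge0// sqr_ge0|exact: HB].
  move=> k _; rewrite sumr_const card_ord -[LHS]mulr_natl exprMn tsq.
  by ring.
have fa : ('E_P[f] <= a%:E)%E.
  rewrite mean_integral.
  have := @integral_le_cst_sum_indic _ _ _ P 'I_0 (fun=> 0) (fun=> 1)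
    (fun=> setT)
    (escape r X) a f; rewrite !big_ord0 addr0; apply => //.
  - by case.
  - by move=> w /fcov[h _]; rewrite big_ord0 addr0.
have mle : fine ('E_P[f])%E <= a by exact: mean_le.
have mge : a - 3 * D * B / n%:R <= fine ('E_P[f])%E.
  have fE := mean_fin_num f0 fa.
  rewrite -lee_fin fineK// mean_integral.
  have a1 (s : 'I_n.+1 * 'I_3) : 0 <= D * t s.1 by exact: g1.
  apply: le_trans; last first.
    apply: (integral_ge_cst_sub_sum_indic a1 mF PF mN PN a0 f0) =>
      w /fcov[_ [s Fs h]].
    rewrite lerBlDr -lerBlDl; apply: le_trans h _.
    exact: (cov_sum w (fun k => D * t k) g1 s Fs).
  by rewrite lee_fin lerD2l lerN2.
rewrite variance_integral; set m := fine _ in mle mge *.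
apply: le_trans.
  have a2 (s : 'I_n.+1 * 'I_3) : 0 <= 2 * (D * t s.1) ^+ 2 by exact: g2.
  apply: (integral_le_cst_sum_indic (c := 2 * (3 * D * B / n%:R) ^+ 2) a2 mF PF
    mN PN).
  - by rewrite mulr_ge0// sqr_ge0.
  - by move=> w; exact: sqr_ge0.
  move=> w /fcov[h1 [s Fs h2]].
  apply: (@le_trans _ _ (2 * (3 * D * B / n%:R) ^+ 2 + 2 * (D * t s.1) ^+ 2)).
    exact: (sqr_sub_le2 h1 h2 mle mge).
  by rewrite lerD2l; exact: (cov_sum w (fun k => 2 * (D * t k) ^+ 2) g2 s Fs).
rewrite lee_fin [leRHS]mulrDl; apply: lerD; last exact: sum2.
by rewrite expr_div_n mulrA.
Qed.

(** * The lower bound on the variance of the number of vertices *)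

(** Requiring these memberships for all l says that x_(f j) is in B_j for all j,
    and that the points which are not of this form are in B0. *)
Definition config (R : realType) (m n : nat) (B : 'I_m -> set (plane R))
    (B0 : set (plane R))
    (f : 'I_m -> 'I_n) (l : 'I_n) : set (plane R) :=
  if [pick j | f j == l] is Some j then B j else B0.

Lemma config_in (R : realType) (m n : nat) (B : 'I_m -> set (plane R))
    (B0 : set (plane R))
    (f : 'I_m -> 'I_n) j : injective f -> config B B0 f (f j) = B j.
Proof.
move=> fi; rewrite /config; case: pickP => [j' /eqP/fi ->//|/(_ j)].
by rewrite eqxx.
Qed.

Lemma config_out (R : realType) (m n : nat) (B : 'I_m -> set (plane R))
    (B0 : set (plane R))
    (f : 'I_m -> 'I_n) l : (forall j, f j != l) -> config B B0 f l = B0.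
Proof. by move=> fl; rewrite /config; case: pickP => // j;
  rewrite (negbTE (fl j)). Qed.

Lemma measurable_config (R : realType) (m n : nat) (B : 'I_m ->
    set (plane R)) B0
    (f : 'I_m -> 'I_n) l : (forall j, measurable (B j)) -> measurable B0 ->
  measurable (config B B0 f l).
Proof. by move=> mB mB0; rewrite /config; case: pickP. Qed.

Lemma config_prob_ge d (T : measurableType d) (R : realType)
    (P : probability T R)
    (r : R) (m n : nat) (X : 'I_n -> {RV P >-> plane R}) (B : 'I_m ->
      set (plane R)) B0
    (f : 'I_m -> 'I_n) (u b0 : R) :
  0 < r -> (0 < n)%N -> uniform_sample (disc (0, 0) r) X -> injective f ->
  (forall j, measurable (B j)) -> measurable B0 ->
  0 <= u -> 0 <= b0 -> b0 <= 1 -> (forall j, u <= unif r (B j)) ->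
    b0 <= unif r B0 ->
  ((u ^+ m * b0 ^+ n)%:E <=
   P (\bigcap_(l in [set: 'I_n]) (X l @^-1` config B B0 f l)))%E.
Proof.
move=> r0 n0 UX fi mB mB0 u0 b00 b01 uB bB0.
rewrite (sample_prod r0 UX); last by move=> l; exact: measurable_config.
rewrite lee_fin (bigID (fun l => l \in codom f))/=.
apply: ler_pM; rewrite ?exprn_ge0//.
- rewrite -(big_uniq _ (_ : uniq (codom f)))/=;
  last by rewrite /codom map_inj_uniq// enum_uniq.
  rewrite big_image -[X in _ ^+ X](card_ord m) -prodr_const.
  by apply: ler_prod => j _; rewrite u0 (config_in _ _ _ fi); exact: uB.
- apply: (@le_trans _ _ (\prod_(l | l \notin codom f) b0)).
    by rewrite prodr_const; apply: ler_wiXn2l => //;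
      rewrite -[leqRHS]card_ord max_card.
  apply: ler_prod => l lf; rewrite b00 config_out; first exact: bB0.
  move=> j.
  by apply: contraNneq lf => <-; exact: codom_f.
Qed.

(** The indices are recovered from the points: f j is the only index of a point
    in B_j. *)
Lemma config_disjoint (R : realType) (m n : nat) (B : 'I_m -> set (plane R)) B0
    (f g : 'I_m -> 'I_n) (x : 'I_n -> plane R) :
  injective f -> injective g ->
  (forall i j p, B i p -> B j p -> i = j) -> (forall j p, B j p -> ~ B0 p) ->
  (forall l, config B B0 f l (x l)) -> (forall l, config B B0 g l (x l)) ->
    f =1 g.
Proof.
move=> fi gi BB BB0 xf xg j.
have := xf (f j); rewrite (config_in _ _ _ fi) => Bj.
have [[j' gj']|ng] := pselect (exists j', g j' = f j); last first.
  have := xg (f j); rewrite config_out; first by move/(BB0 _ _ Bj).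
  by move=> j'; apply/eqP => e; apply: ng; exists j'.
have := xg (f j); rewrite -gj' (config_in _ _ _ gi) => Bj'.
rewrite -gj' in Bj *; by rewrite (BB _ _ _ Bj Bj').
Qed.

(** The events attached to the n (n-1) ... (n-m+1) injections are disjoint, each
    has probability at least u^m b0^n, and g >= 1/4 on each of them. *)
Lemma config_var_ge d (T : measurableType d) (R : realType)
    (P : probability T R)
    (r : R) (m n : nat) (X : 'I_n -> {RV P >-> plane R}) (B : 'I_m ->
      set (plane R)) B0
    (u b0 : R) (g : T -> R) :
  0 < r -> (0 < n)%N -> uniform_sample (disc (0, 0) r) X ->
  (forall j, measurable (B j)) -> measurable B0 ->
  (forall i j p, B i p -> B j p -> i = j) -> (forall j p, B j p -> ~ B0 p) ->
  0 <= u -> 0 <= b0 -> b0 <= 1 -> (forall j, u <= unif r (B j)) ->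
    b0 <= unif r B0 ->
  (forall w, 0 <= g w) ->
  (forall (f : 'I_m -> 'I_n) w, injective f ->
     (forall l, config B B0 f l (X l w)) -> 1 / 4 <= g w) ->
  ((1 / 4 * ((n ^_ m)%:R * (u ^+ m * b0 ^+ n)))%:E <= \int[P]_w (g w)%:E)%E.
Proof.
move=> r0 n0 UX mB mB0 BB BB0 u0 b00 b01 uB bB0 g0 gc.
pose J := {ffun 'I_m -> 'I_n}.
pose F (f : J) := \bigcap_(l in [set: 'I_n]) (X l @^-1` config B B0 f l).
pose a (f : J) : R := 1 / 4 * (injectiveb f)%:R.
have a0 f : 0 <= a f by rewrite /a mulr_ge0.
have mF f : measurable (F f) by apply: measurable_sample => l;
  exact: measurable_config.
pose p (f : J) : R := (injectiveb f)%:R * (u ^+ m * b0 ^+ n).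
have pF f : ((p f)%:E <= P (F f))%E.
  rewrite /p; have [fi|_] := boolP (injectiveb f); last by rewrite mul0r;
    exact: measure_ge0.
  by rewrite mul1r; apply: (config_prob_ge r0 n0 UX) => //; exact/injectiveP.
have -> : 1 / 4 * ((n ^_ m)%:R * (u ^+ m * b0 ^+ n)) = \sum_f a f * p f.
  have -> : (n ^_ m)%:R = \sum_(f : J) (injectiveb f)%:R :> R.
    rewrite -[n in LHS]card_ord -[m in LHS]card_ord -card_inj_ffuns -sum1_card
      natr_sum.
    rewrite big_mkcond; apply: eq_bigr => f _.
    by rewrite inE; case: (injectiveb f).
  rewrite mulr_suml mulr_sumr; apply: eq_bigr => f _; rewrite /a /p.
  by case: (injectiveb f); rewrite /= ?mul1r ?mulr1 ?mul0r ?mulr0.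
apply: (integral_ge_sum_indic a0 mF pF) => w.
have [[f fi Ff]|nF] := pselect (exists2 f : J, injective f & F f w); last first.
  rewrite big1// => f _; rewrite /a;
    have [/injectiveP fi|_] := boolP (injectiveb f).
    by rewrite indicE memNset ?mulr0// => Ff; apply: nF; exists f.
  by rewrite mulr0 mul0r.
rewrite (bigD1 f)//= big1 => [|f' f'f].
  rewrite addr0; apply: (@le_trans _ _ (1 / 4)); last first.
    by apply: (gc f) => // l; exact: Ff.
  have fb : injectiveb f by exact/injectiveP.
  by rewrite /a fb mulr1 indicE mem_set// mulr1.
rewrite /a; have [/injectiveP fi'|_] := boolP (injectiveb f');
  last by rewrite mulr0 mul0r.
rewrite indicE memNset ?mulr0// => Ff'; move/eqP: f'f; apply; apply/ffunP.
exact: (config_disjoint fi' fi BB BB0 (fun l => Ff' l I) (fun l => Ff l I)).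
Qed.

(** The number of injections is at least (n/2)^m, which compensates for the
    factor n^-m. *)
Lemma config_weight_ge (R : realType) (K : R) (n m : nat) : 1 <= K ->
  (8 <= n)%N -> (m <= 4)%N -> 2 * K <= n%:R ->
  (1 / (2 * K)) ^+ 4 * expR (- (2 * K)) <=
  (n ^_ m)%:R * ((1 / n%:R / K) ^+ m * (1 - K / n%:R) ^+ n).
Proof.
move=> K1 n8 m4 nK; have n0 : 0 < n%:R :> R by rewrite ltr0n; lia.
have K0 : 0 < K by lra.
rewrite mulrA; apply: ler_pM.
- by rewrite exprn_ge0// divr_ge0// mulr_ge0// ltW.
- exact: expR_ge0.
- apply: (@le_trans _ _ ((n%:R / 2) ^+ m * (1 / n%:R / K) ^+ m)).
    rewrite -exprMn; have -> : n%:R / 2 * (1 / n%:R / K) = 1 / (2 * K).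
      by field; rewrite !gt_eqF.
    apply: ler_wiXn2l => //; first by rewrite divr_ge0// mulr_ge0// ltW.
    by rewrite ler_pdivrMr ?mulr_gt0//; lra.
  apply: ler_wpM2r; last by apply: ffact_ge; lia.
  by rewrite exprn_ge0// !divr_ge0// ltW.
- by apply: one_sub_div_pow_ge => //; [lia|exact: ltW].
Qed.

(** If the mean is at least 7/2 the configurations with at most three vertices
    are used, and otherwise those with at least four. *)
Lemma f0_var_ge d (T : measurableType d) (R : realType) (P : probability T R)
    (r : R) (n : nat) (X : 'I_n -> {RV P >-> plane R}) : 0 < r -> (8 <= n)%N ->
  2 * rim_rate R <= n%:R ->
  uniform_sample (disc (0, 0) r) X ->
  ((1 / 4 * ((1 / (2 * rim_rate R)) ^+ 4 * expR (- (2 * rim_rate R))))%:E <=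
   'V_P[fun w => (f0 r (random_disc_polygon r X w))%:R])%E.
Proof.
move=> r0 n8; set K := rim_rate R => nC UX.
have K1 : 1 <= K by exact: rim_rate_ge1.
have K0 : 0 < K by lra.
have n0 : (0 < n)%N by exact: leq_trans n8.
have n0' : 0 < n%:R :> R by rewrite ltr0n.
rewrite variance_integral; set mu := fine _.
pose t : R := 1 / n%:R; pose h := r / 10 * t.
have t0 : 0 < t by rewrite divr_gt0.
have t1 : t <= 1 by rewrite ler_pdivrMr// mul1r -[leLHS]/(1%:R) ler_nat.
have h0 : 0 < h by rewrite mulr_gt0// divr_gt0.
have hr : h <= r / 10 by rewrite ler_piMr// divr_ge0// ltW.
have hE : 20 * h = 2 * r * t by rewrite /h; field.
pose B0 := ~` rim r (20 * h).
have mA : measurable (rim r (20 * h)) by exact: measurable_rim.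
have b0 : 1 - K / n%:R <= unif r B0.
  rewrite /B0 unifC// lerD2l lerN2 hE.
  have -> : K / n%:R = K * t by rewrite /t mul1r.
  exact: unif_rim_step r0 (ltW t0).
have b1 : 0 <= 1 - K / n%:R :> R by rewrite subr_ge0 ler_pdivrMr// mul1r; lra.
have b2 : 1 - K / n%:R <= 1 :> R.
  by rewrite lerBlDr lerDl; apply: divr_ge0; exact: ltW.
have u0 : 0 <= t / K by apply: divr_ge0; exact: ltW.
have g0 w : 0 <= ((f0 r (random_disc_polygon r X w))%:R - mu) ^+ 2
  by exact: sqr_ge0.
have fin m (B : 'I_m -> set (plane R)) : (m <= 4)%N ->
    (forall j, measurable (B j)) ->
    (forall i j p, B i p -> B j p -> i = j) -> (forall j p, B j p -> ~ B0 p) ->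
    (forall j, t / K <= unif r (B j)) ->
    (forall (f : 'I_m -> 'I_n) w, injective f ->
     (forall l, config B B0 f l (X l w)) ->
     1 / 4 <= ((f0 r (random_disc_polygon r X w))%:R - mu) ^+ 2) ->
    ((1 / 4 * ((1 / (2 * K)) ^+ 4 * expR (- (2 * K))))%:E <=
     \int[P]_w ((((f0 r (random_disc_polygon r X w))%:R - mu) ^+ 2)%:E))%E.
  move=> m4 mB BB BB0 uB gc.
  apply: le_trans (config_var_ge r0 n0 UX mB
    (measurableC mA) BB BB0 u0 b1 b2 uB b0 g0 gc).
  rewrite lee_fin; apply: ler_wpM2l; first by rewrite divr_ge0.
  exact: config_weight_ge.
have hits m (B : 'I_m -> set (plane R)) (f : 'I_m -> 'I_n) w : injective f ->
    (forall l, config B B0 f l (X l w)) ->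
    (forall j, B j (X (f j) w)) /\
    (forall l, (forall j, f j != l) -> ~ rim r (20 * h) (X l w)).
  move=> fi H; split=> [j|l fl]; first by have := H (f j); rewrite config_in.
  by have := H l; rewrite config_out.
have [m3|m3] := leP (7 / 2) mu.
  apply: (fin 3 (tri_strip r h)); first by [].
  - by move=> j; exact: measurable_tri.
  - by move=> i j p; exact: tri_inj.
  - by move=> j p /(tri_sub_rim (ltW h0) hr) H; apply.
  - move=> j; apply: le_trans (unif_tri_ge j r0 (ltW t0) t1).
    rewrite /K /rim_rate; clear - t0; lra.
  - move=> f w fi /(hits _ _ _ _ fi)[H1 H2].
    have f3 : (f0 r (random_disc_polygon r X w) <= 3)%N.
      exact: (tri_f0_le (x := fun l => X l w) r0 (ltW h0) hr H1 H2).
    by apply: sqr_dist_ge_below m3 _; rewrite ler_nat.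
apply: (fin 4 (quad_strip r h)); first by [].
- by move=> j; exact: measurable_quad.
- by move=> i j p; exact: quad_inj r0 (ltW h0) hr.
- by move=> j p /(quad_sub_rim (ltW h0) hr) H; apply.
- by move=> j; exact: unif_quad_ge j r0 (ltW t0) t1.
- move=> f w fi /(hits _ _ _ _ fi)[H1 H2].
  have f4 : (4 <= f0 r (random_disc_polygon r X w))%N.
    exact: (quad_f0_ge (x := fun l => X l w) r0 h0 hr H1 H2).
  by apply: sqr_dist_ge_above m3 _; rewrite ler_nat.
Qed.

Unset Implicit Arguments.

Theorem theorem4 (R : realType) (r : R) (hr : 0 < r) :
  exists (c C : R) (n0 : nat),
    [/\ 0 < c, c <= C &
      forall (n : nat), (n0 <= n)%N ->
      forall (d : measure_display) (T : measurableType d)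
        (P : probability T R) (X : 'I_n -> {RV P >-> plane R}),
      uniform_sample (disc (0, 0) r) X ->
      [/\ (c%:E <= 'V_P[fun w => (f0 r (random_disc_polygon r X w))%:R])%E,
          ('V_P[fun w => (f0 r (random_disc_polygon r X w))%:R] <= C%:E)%E &
          ('V_P[fun w => fine (area (random_disc_polygon r X w))]
             <= (C * n%:R ^- 2)%:E)%E]].
Proof.
have /andP[q0 q1] := miss_rate_itv R.
have [B B0 HB] := sum_sqr_geo_le q0 q1.
pose K := rim_rate R.
have K0 : 0 < K by exact: lt_le_trans ltr01 (rim_rate_ge1 R).
pose c : R := 1 / 4 * ((1 / (2 * K)) ^+ 4 * expR (- (2 * K))).
pose M : R := 3 * (rim_rate R + rim_rate R ^+ 2) * B.
pose D : R := 80 * r ^+ 2.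
pose V : R := 2 * (3 * D * B) ^+ 2 + 6 * D ^+ 2 * B.
pose C := c + (M ^+ 2 + M) + V.
have c0 : 0 < c.
  rewrite /c; apply: mulr_gt0; first by rewrite divr_gt0.
  apply: mulr_gt0; last exact: expR_gt0.
  by rewrite exprn_gt0// divr_gt0// mulr_gt0.
have M0 : 0 <= M ^+ 2 + M.
  apply: addr_ge0; first exact: sqr_ge0.
  rewrite /M; apply: mulr_ge0 B0; apply: mulr_ge0; first exact: ler0n.
  by apply: addr_ge0; [exact: rim_rate_ge0|exact: sqr_ge0].
have V0 : 0 <= V.
  rewrite /V; apply: addr_ge0.
    by apply: mulr_ge0; [exact: ler0n|exact: sqr_ge0].
  by apply: mulr_ge0 B0; apply: mulr_ge0; [exact: ler0n|exact: sqr_ge0].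
(* n >= 8 makes the factors of n (n-1) (n-2) (n-3) at least n/2, and n >= 2 K
   makes the probability of the rim of width 2 r / n at most 1/2 *)
exists c, C, (8 + Num.truncn (2 * K))%N; split => //.
  by rewrite /C -addrA lerDl addr_ge0.
move=> n nn d T P X UX.
have n8 : (8 <= n)%N by apply: leq_trans nn; exact: leq_addr.
have n3 : (3 <= n)%N by exact: leq_trans n8.
have nC : 2 * K <= n%:R.
  apply/ltW/(lt_le_trans (truncnS_gt _)); rewrite ler_nat.
  by apply: leq_trans nn; rewrite addSn ltnS leq_addl.
split.
- exact: f0_var_ge hr n8 nC UX.
- apply: le_trans (f0_var_le hr n3 HB (erefl M) UX) _.
  by rewrite lee_fin /C addrAC lerDr addr_ge0// ltW.
- apply: le_trans (area_var_le hr n3 HB (erefl D) UX) _.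
  rewrite lee_fin; apply: ler_wpM2r; first by rewrite invr_ge0 sqr_ge0.
  by rewrite /C lerDr addr_ge0// ltW.
Qed.
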